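(* Let $n\ge5$. Suppose the system $Bx\ge b$ consists of inequalities defining NR-facets of $P$. If the relaxation $$Bx\ge b,\qquad \delta_v\cdot x\ge1\ \ \forall v\in V_n,\qquad x\ge0$$ of $S$ has the parsimonious property, then every connected component of $\mathcal{G}_B$ contains vertices corresponding to NR-facets of $P$.
   Context: Fix an integer $n\ge5$. Let $V_n=\{1,\dots,n\}$ and let $E_n$ be the set of all two-element subsets $uv:=\{u,v\}$ of $V_n$. Write $x\cdot y$ for the standard inner product on $\mathbb{R}^{E_n}$. $S\subset\mathbb{R}^{E_n}$ is the Symmetric Traveling Salesman Polytope, i.e. the convex hull of the characteristic vectors of the edge sets of all cycles with vertex set $V_n$ (Hamilton cycles of $K_n$). $P\subset\mathbb{R}^{E_n}$ is the Graphical Traveling Salesman Polyhedron, i.e. the convex hull of all $x\in\mathbb{Z}_+^{E_n}$ such that the multigraph on vertex set $V_n$ with $x_e$ copies of each edge $e$ is connected and Eulerian (all degrees even). It is known that $P$ is full-dimensional and $S$ is a face of $P$. For $u\in V_n$, $\delta_u\in\mathbb{R}^{E_n}$ has entry $1/2$ on all edges incident to $u$ and $0$ elsewhere. The non-negativity facets of $P$ are those defined by $x_e\ge0$, $e\in E_n$; the degree facets of $P$ are those defined by $\delta_u\cdot x\ge1$, $u\in V_n$; all other facets of $P$ are called TT-facets. A TT-facet $G$ of $P$ is an NR-facet if $G\cap S$ is a facet of $S$, and a non-NR-facet otherwise. Parsimonious property. For a (finite) system $Bx\ge b$ of linear inequalities valid for $S$, the relaxation consisting of $Bx\ge b$, $\delta_v\cdot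 x\ge1$ ($v\in V_n$), $x\ge0$ has the parsimonious property if $$\min\{c\cdot x\mid Bx\ge b,\ \delta_v\cdot x\ge1\ \forall v,\ x\ge0\}=\min\{c\cdot x\mid Bx\ge b,\ \delta_v\cdot x=1\ \forall v,\ x\ge0\}$$ for all $c\in\mathbb{R}^{E_n}$ satisfying the triangle inequality, i.e. $c_{vu}+c_{uw}-c_{vw}\ge0$ for all distinct $u,v,w\in V_n$. Ridge graph. The ridge graph $\mathcal{G}$ of $P$ has as vertices the facets of $P$, two facets being adjacent if their intersection has dimension $\dim P-2$. $\mathcal{G}_B$ is the induced subgraph of $\mathcal{G}$ obtained by deleting all vertices corresponding to facets defined by inequalities in the relaxation, i.e. the facets defined by rows of $Bx\ge b$, all degree facets, and all non-negativity facets. *)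

(* Defs.v *)
From HB Require Import structures.
From Stdlib Require Export Relation_Operators.
From mathcomp Require Export all_boot all_order all_algebra.
From mathcomp Require Export boolp classical_sets reals convex.

Set Implicit Arguments.
Unset Strict Implicit.
Unset Printing Implicit Defensive.

Import Order.TTheory GRing.Theory Num.Theory.
Local Open Scope classical_set_scope.
Local Open Scope ring_scope.

Definition edge (n : nat) := {e : {set 'I_n} | #|e| == 2%N}.

(* The codomain is R^o so that vec R n is a vectType over R. *)
Definition vec (R : realType) (n : nat) := {ffun edge n -> R^o}.

Definition dot (R : realType) (n : nat) (x y : vec R n) : R :=
  \sum_(e : edge n) (x e : R) * (y e : R).

Definition convex_hull (R : realType) (n : nat) (A : set (vec R n)) :
  set (vec R n) := smallest (@convex_set R (vec R n)) A.

Definition affine_hull (R : realType) (n : nat) (A : set (vec R n)) :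
  set (vec R n) :=
  [set x | exists k (p : 'I_k -> vec R n) (l : 'I_k -> R),
    [/\ forall i, A (p i), \sum_i l i = 1 & x = \sum_i l i *: p i]].

(* A is nonempty and its affine hull is a translate of a d-dimensional linear
   subspace; no d : nat satisfies this when A is empty. *)
Definition has_dim (R : realType) (n : nat) (A : set (vec R n)) (d : nat) :=
  exists (x0 : vec R n) (U : {vspace vec R n}),
    affine_hull A = [set x | x - x0 \in U] /\ \dim U = d.

Definition has_codim (R : realType) (n : nat) (Q F : set (vec R n))
  (k : nat) := exists d, has_dim Q (d + k)%N /\ has_dim F d.

Definition valid (R : realType) (n : nat) (Q : set (vec R n))
  (a : vec R n) (b : R) := forall x, Q x -> b <= dot a x.

Definition defines (R : realType) (n : nat) (Q : set (vec R n))
  (a : vec R n) (b : R) (F : set (vec R n)) :=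
  valid Q a b /\ F = Q `&` [set x | dot a x = b].

Definition facet (R : realType) (n : nat) (Q F : set (vec R n)) :=
  (exists a b, defines Q a b F) /\ has_codim Q F 1.

(* The edges of the cycle p_0 p_1 ... p_(k-1) p_0. *)
Definition cycle_edges (n : nat) (p : seq 'I_n) : {set edge n} :=
  [set e : edge n | [exists u in p, val e == [set u; next p u]%SET]]%SET.

Definition hamilton_cycle (n : nat) (C : {set edge n}) :=
  exists p : seq 'I_n, [/\ uniq p, p =i 'I_n & C = cycle_edges p].

Definition char_vec (R : realType) (n : nat) (C : {set edge n}) : vec R n :=
  [ffun e => (e \in C)%:R].

Definition stsp (R : realType) (n : nat) : set (vec R n) :=
  convex_hull [set x | exists2 C, hamilton_cycle C & x = char_vec R C].

Arguments stsp : clear implicits.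

Definition mg_connected (n : nat) (m : edge n -> nat) :=
  forall u v : 'I_n,
    connect (fun s t =>
      [exists e : edge n, (val e == [set s; t]%SET) && (0 < m e)%N]) u v.

Definition mg_even (n : nat) (m : edge n -> nat) :=
  forall u : 'I_n, ~~ odd (\sum_(e : edge n | u \in val e) m e)%N.

Definition gtsp (R : realType) (n : nat) : set (vec R n) :=
  convex_hull [set x | exists m : edge n -> nat,
    [/\ mg_connected m, mg_even m & x = [ffun e => (m e)%:R]]].

Arguments gtsp : clear implicits.

Definition delta (R : realType) (n : nat) (u : 'I_n) : vec R n :=
  [ffun e : edge n => if u \in val e then 2^-1 else 0].

Definition unit_vec (R : realType) (n : nat) (e : edge n) : vec R n :=
  [ffun f => (f == e)%:R].

Definition nonneg_facet (R : realType) (n : nat) (F : set (vec R n)) :=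
  facet (gtsp R n) F /\ exists e, defines (gtsp R n) (unit_vec R e) 0 F.

Definition degree_facet (R : realType) (n : nat) (F : set (vec R n)) :=
  facet (gtsp R n) F /\ exists u, defines (gtsp R n) (delta R u) 1 F.

Definition tt_facet (R : realType) (n : nat) (F : set (vec R n)) :=
  [/\ facet (gtsp R n) F, ~ nonneg_facet F & ~ degree_facet F].

Definition nr_facet (R : realType) (n : nat) (F : set (vec R n)) :=
  tt_facet F /\ facet (stsp R n) (F `&` stsp R n).

Definition triangle_ineq (R : realType) (n : nat) (c : vec R n) :=
  forall (u v w : 'I_n) (vu uw vw : edge n),
    u != v -> u != w -> v != w ->
    val vu = [set v; u]%SET -> val uw = [set u; w]%SET ->
    val vw = [set v; w]%SET ->
    0 <= (c vu : R) + (c uw : R) - (c vw : R).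

Definition relaxation (R : realType) (n m : nat) (B : 'I_m -> vec R n)
  (b : 'I_m -> R) : set (vec R n) :=
  [set x | [/\ forall i, b i <= dot (B i) x,
               forall v, 1 <= dot (delta R v) x
             & forall e, 0 <= (x e : R)]].

Definition relaxation_eq (R : realType) (n m : nat) (B : 'I_m -> vec R n)
  (b : 'I_m -> R) : set (vec R n) :=
  [set x | [/\ forall i, b i <= dot (B i) x,
               forall v, dot (delta R v) x = 1
             & forall e, 0 <= (x e : R)]].

Definition is_min (R : realType) (A : set R) (t : R) := A t /\ lbound A t.

Definition parsimonious (R : realType) (n m : nat) (B : 'I_m -> vec R n)
  (b : 'I_m -> R) :=
  forall c : vec R n, triangle_ineq c ->
    exists t, is_min [set dot c x | x in relaxation B b] t /\
              is_min [set dot c x | x in relaxation_eq B b] t.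

Definition ridge_adj (R : realType) (n : nat) (F G : set (vec R n)) :=
  [/\ facet (gtsp R n) F, facet (gtsp R n) G
    & has_codim (gtsp R n) (F `&` G) 2].

Definition row_facet (R : realType) (n m : nat) (B : 'I_m -> vec R n)
  (b : 'I_m -> R) (F : set (vec R n)) :=
  facet (gtsp R n) F /\ exists i, defines (gtsp R n) (B i) (b i) F.

Definition GB_vertex (R : realType) (n m : nat) (B : 'I_m -> vec R n)
  (b : 'I_m -> R) : set (set (vec R n)) :=
  [set F | [/\ facet (gtsp R n) F, ~ row_facet B b F, ~ degree_facet F
             & ~ nonneg_facet F]].

Definition connected_component (T : Type) (V : set T) (adj : T -> T -> Prop)
  (K : set T) :=
  exists2 F, V F &
    K = [set G | clos_refl_trans T
                   (fun X Y => [/\ V X, V Y & adj X Y]) F G].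

(* Main.v *)
From HB Require Import structures.
Require Import Defs.
From mathcomp Require Import interval_inference ring lra zify.

(** A facet F of P that lies outside the relaxation, with inequality
    [a . x >= al], leads to an NR-facet of its component as follows.

    Some point of F satisfies every inequality of the relaxation strictly, so a
    small step across F yields x strictly inside the relaxation with
    [a . x < al] ([exists_point_beyond]).  Since F is no non-negativity facet, F
    contains a tour through any prescribed edge; replacing that edge by a detour
    over a third vertex gives a point of P again, which shows that a satisfies
    the triangle inequality ([facet_triangle]).  The parsimonious property for
    the objective a now provides q in the relaxation with all degree
    inequalities tight and [a . q < al].  Because S is the face of P where all
    degree inequalities are tight ([stsp_face]) and the inequality of F is valid
    for P, the point q is not in S.

    Hence q violates an NR-facet F0 ([nr_facet_separates]).  Indeed S spans the
    affine space L where all degree inequalities are tight, because a linear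
    function that is constant on Hamilton cycles is a combination of degrees
    ([tour_constant_delta]).  Among the facet inequalities of P, an irredundant
    system describing S inside L has a member violated by q, every member of it
    defines a facet of S ([cell_facet]), and a member violated by q is neither a
    degree inequality nor a non-negativity inequality.

    A point y of the segment from q to x close to q violates the inequalities of
    F and F0, and it satisfies the whole relaxation strictly.  So the facets of P
    visible from y are all vertices of the induced ridge graph.  The visible
    facets of a polyhedron are connected through ridges
    ([visible_facets_connected]): seen from a relative interior point g of F0,
    the hyperplane of a visible facet G is crossed by the segment from g to y at a
    point outside P, and a ridge of G that is violated there leads to a facet
    whose hyperplane is crossed earlier; the first hyperplane crossed is that of
    F0.

    These arguments need P to be the solution set of a finite system.  Removing
    pairs of parallel edges shows that P is the convex hull of finitely many
    points plus the non-negative orthant ([gtsp_cone]), and Fourier-Motzkin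
    elimination applies ([cone_polyhedral]). *)

Set Implicit Arguments.
Unset Strict Implicit.
Unset Printing Implicit Defensive.

Import Order.TTheory GRing.Theory Num.Theory.
Local Open Scope classical_set_scope.
Local Open Scope ring_scope.

(** * Linear functionals and affine dimension *)

Section Euclidean.
Variables (R : realType) (n : nat).
Implicit Types (x y z a u : vec R n) (c d : vec R n * R) (t : R).
Implicit Types (A X Q F G : set (vec R n)) (I : seq (vec R n * R)).

Lemma dotDr a x y : dot a (x + y) = dot a x + dot a y.
Proof.
by rewrite /dot -big_split; apply: eq_bigr => e _; rewrite ffunE mulrDr.
Qed.

Lemma dotZr a t x : dot a (t *: x) = t * dot a x.
Proof.
by rewrite /dot mulr_sumr; apply: eq_bigr => e _; rewrite ffunE mulrCA.
Qed.

Lemma dotC x y : dot x y = dot y x.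
Proof. by apply: eq_bigr => e _; rewrite mulrC. Qed.

Lemma dotDl a x y : dot (x + y) a = dot x a + dot y a.
Proof. by rewrite dotC dotDr !(dotC a). Qed.

Lemma dotZl a t x : dot (t *: x) a = t * dot x a.
Proof. by rewrite dotC dotZr dotC. Qed.

Lemma dotNr a x : dot a (- x) = - dot a x.
Proof. by rewrite -scaleN1r dotZr mulN1r. Qed.

Lemma dotBr a x y : dot a (x - y) = dot a x - dot a y.
Proof. by rewrite dotDr dotNr. Qed.

Lemma dot0l x : dot 0 x = 0.
Proof. by rewrite -(scale0r 0) dotZl mul0r. Qed.

Lemma dot0r x : dot x 0 = 0.
Proof. by rewrite dotC dot0l. Qed.

Lemma dot_sumr J (r : seq J) (P : pred J) a (f : J -> vec R n) :
  dot a (\sum_(j <- r | P j) f j) = \sum_(j <- r | P j) dot a (f j).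
Proof. by apply: (big_morph _ (dotDr a) (dot0r a)). Qed.

Lemma dot_unit a e : dot a (unit_vec R e) = a e.
Proof.
rewrite /dot (bigD1 e) //= ffunE eqxx mulr1 big1 ?addr0 // => f /negPf fe.
by rewrite ffunE fe mulr0.
Qed.

Lemma dot_is_linear a : linear (dot a : vec R n -> R^o).
Proof. by move=> t x y; rewrite dotDr dotZr. Qed.

HB.instance Definition _ a :=
  GRing.isLinear.Build R (vec R n) R^o *:%R (dot a) (dot_is_linear a).

Definition dot_ker a : {vspace vec R n} := lker (linfun (dot a : vec R n -> R^o)).

Lemma mem_dot_ker a x : (x \in dot_ker a) = (dot a x == 0).
Proof. by rewrite memv_ker lfunE. Qed.

Lemma dim_cap_dot_ker (U : {vspace vec R n}) a u :
  u \in U -> dot a u != 0 -> (\dim (U :&: dot_ker a)).+1 = \dim U.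
Proof.
move=> uU au0; rewrite -(limg_ker_dim (linfun (dot a : _ -> R^o)) U) -addn1.
congr (_ + _)%N; apply/esym/eqP; rewrite eqn_leq; apply/andP; split.
  by apply: leq_trans (dimvS (subvf _)) _; rewrite dimvf.
rewrite lt0n dimv_eq0; apply: contra au0 => /eqP im0.
have := memv_img (linfun (dot a : _ -> R^o)) uU.
by rewrite im0 memv0 lfunE.
Qed.

Definition slack c x : R := dot c.1 x - c.2.

Lemma slackZ c x t u : slack c (x + t *: u) = slack c x + t * dot c.1 u.
Proof. by rewrite /slack dotDr dotZr addrAC. Qed.

Lemma slack_seg c x y t :
  slack c (x + t *: (y - x)) = (1 - t) * slack c x + t * slack c y.
Proof. by rewrite slackZ /slack dotBr; ring. Qed.

(** An open condition given by finitely many inequalities survives a small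
    step in any direction. *)
Lemma exists_small_step I x u :
  (forall c, c \in I -> 0 < slack c x) ->
  exists2 t, 0 < t < 1 &
    forall c s, c \in I -> 0 <= s <= t -> 0 < slack c (x + s *: u).
Proof.
elim: I => [|c I IH] Ipos; first by exists (2^-1) => //; lra.
have {IH} [|t t01 tI] := IH.
  by move=> d dI; apply: Ipos; rewrite inE dI orbT.
have cx : 0 < slack c x by apply: Ipos; rewrite mem_head.
set D := `|dot c.1 u| + slack c x.
have Dge : `|dot c.1 u| < D by rewrite /D; lra.
have D0 : 0 < D by apply: le_lt_trans Dge.
have r0 : 0 < slack c x / D by rewrite divr_gt0.
exists (Num.min t (slack c x / D)).
  by rewrite lt_min gt_min r0; case/andP: t01 => -> ->.
move=> d s; rewrite inE le_min => /orP[/eqP ->|dI] /and3P[s0 st sr]; last first.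
  by apply: tI; rewrite ?dI ?s0.
rewrite slackZ; have := ler_norm (- dot c.1 u); rewrite normrN => nle.
have : s * D <= slack c x by rewrite -ler_pdivlMr.
have := ler_wpM2l s0 nle; have := ler_wpM2l s0 (ltW Dge).
case/boolP: (s == 0) => [/eqP ->|sn0]; first by lra.
have sp : 0 < s by rewrite lt_neqAle eq_sym sn0.
have : s * `|dot c.1 u| < s * D by rewrite ltr_pM2l.
lra.
Qed.

Lemma affine_hull_slack A c :
  (forall x, A x -> slack c x = 0) -> forall x, affine_hull A x -> slack c x = 0.
Proof.
move=> Ac x [k [p [l [Ap l1 ->]]]]; rewrite /slack dot_sumr.
rewrite (eq_bigr (fun i => l i * c.2)) => [|i _].
  by rewrite -mulr_suml l1 mul1r subrr.
by rewrite dotZr; congr (_ * _); apply/eqP; rewrite -subr_eq0 -(Ac (p i)).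
Qed.

Lemma affine_hull_nonempty A x : affine_hull A x -> exists y, A y.
Proof.
move=> [[|k] [p [l [Ap l1 _]]]]; last by exists (p ord0).
by move: l1; rewrite big_ord0 => /esym/eqP; rewrite oner_eq0.
Qed.

(** The affine hull of A is recovered by scaling the small steps that stay in
    A, so the dimension of A can be read off at one point. *)
Lemma has_dim_relative_interior A x0 (U : {vspace vec R n}) :
  (forall x, A x -> x - x0 \in U) ->
  (forall u, u \in U -> exists2 t, 0 < t & A (x0 + t *: u)) ->
  has_dim A (\dim U).
Proof.
move=> AU UA; exists x0, U; split=> //; apply/seteqP; split=> x /=.
  move=> [k [p [l [Ap l1 ->]]]].
  rewrite -[x0 in X in X \in _]scale1r -l1 scaler_suml -sumrB memv_suml // => i _.
  by rewrite -scalerBr memvZ // AU.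
move=> xU; have [t t0 At] := UA _ xU.
(* x is the affine combination of x0 and x0 + t (x - x0) with weights 1 - 1/t, 1/t *)
have [s _] := UA 0 (mem0v _); rewrite scaler0 addr0 => Ax0.
exists 2%N, (fun i => if i == 0 :> nat then x0 else x0 + t *: (x - x0)).
exists (fun i => if i == 0 :> nat then 1 - t^-1 else t^-1).
split; first by case=> [[|[|]]].
  by rewrite big_ord_recl big_ord1 /=; ring.
rewrite big_ord_recl big_ord1 /= scalerDr scalerA mulVf ?gt_eqF // scale1r.
by rewrite scalerBl scale1r addrA subrK addrC subrK.
Qed.

Lemma has_dim_uniq A k l : has_dim A k -> has_dim A l -> k = l.
Proof.
have sub x0 x1 (U V : {vspace vec R n}) :
    [set x | x - x0 \in U] `<=` [set x | x - x1 \in V] -> (U <= V)%VS.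
  move=> UV; apply/subvP => u uU.
  have uV : x0 + u - x1 \in V by apply: UV; rewrite /= addrAC subrr add0r.
  have x0V : x0 - x1 \in V by apply: UV; rewrite /= subrr mem0v.
  by have := memvB uV x0V; rewrite opprB addrA subrK addrAC subrr add0r.
move=> [x0 [U [e1 <-]]] [x1 [V [e2 <-]]]; congr (\dim _).
apply/eqP; rewrite eqEsubv; apply/andP; split.
  by apply: (sub x0 x1); rewrite -e1 e2.
by apply: (sub x1 x0); rewrite -e2 e1.
Qed.

End Euclidean.

(** * Facets of a polyhedron *)

Section Polyhedra.
Variables (R : realType) (n : nat).
Implicit Types (x y z a u : vec R n) (c d : vec R n * R) (t : R).
Implicit Types (A X Q F G : set (vec R n)) (I : seq (vec R n * R)).
Implicit Types (U : {vspace vec R n}).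

Definition cell x0 U I : set (vec R n) :=
  [set x | x - x0 \in U /\ forall c, c \in I -> 0 <= slack c x].

(** If some inequality can be dropped without changing the cell, drop it.
    Otherwise any violated inequality c works: dropping c admits a point z beyond
    its hyperplane, and where the segment from the strict point x0 to z crosses
    that hyperplane all other inequalities are strict. *)
Lemma cell_facet I x0 U q :
    (forall c, c \in I -> 0 < slack c x0) -> q - x0 \in U -> ~ cell x0 U I q ->
  exists c, [/\ c \in I, slack c q < 0 & exists2 k, k.+1 = \dim U &
    has_dim (cell x0 U I `&` [set x | slack c x = 0]) k].
Proof.
have [s] := ubnP (size I); elim: s I => // s IH I sI Ipos qU qI.
have [[d [dI dred]]|irr] := pselect (exists d, d \in I /\
    cell x0 U [seq c <- I | c != d] `<=` cell x0 U I).
  set J := [seq c <- I | c != d] in dred.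
  have JI c : c \in J -> c \in I by rewrite mem_filter => /andP[].
  have eqJ : cell x0 U J = cell x0 U I.
    apply/seteqP; split=> // x [xU xI]; split=> // c /JI; exact: xI.
  have sJ : (size J < s)%N.
    rewrite size_filter -ltnS; apply: leq_trans sI.
    rewrite ltnS -(count_predC (pred1 d) I) -[X in (X < _)%N]add0n ltn_add2r.
    by rewrite -has_count has_pred1.
  have [||c [cJ cq kP]] := IH J sJ _ qU.
  - by move=> c /JI; apply: Ipos.
  - by rewrite eqJ.
  - by exists c; split; [exact: JI| |rewrite -eqJ].
have [c cI cq] : exists2 c, c \in I & slack c q < 0.
  apply: contrapT => nviol; apply: qI; split=> // c cI.
  by rewrite leNgt; apply/negP => cq; apply: nviol; exists c.
exists c; split=> //.
have [z [zU zI] zc] : exists2 z, cell x0 U [seq d <- I | d != c] z & slack c z < 0.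
  apply: contrapT => nz; apply: irr; exists c; split=> // z zI.
  split=> [|d dI]; first by case: zI.
  have [->|dc] := eqVneq d c; last by case: zI => _; apply; rewrite mem_filter dc.
  by rewrite leNgt; apply/negP => cz; apply: nz; exists z.
have cx0 := Ipos _ cI.
set t := slack c x0 / (slack c x0 - slack c z); set w := x0 + t *: (z - x0).
have D0 : 0 < slack c x0 - slack c z by lra.
have t0 : 0 < t by rewrite divr_gt0.
have t1 : t < 1 by rewrite /t ltr_pdivrMr // mul1r; lra.
have cw : slack c w = 0 by rewrite slack_seg /t; field; rewrite gt_eqF.
have wpos d : d \in [seq d <- I | d != c] -> 0 < slack d w.
  move=> dI; rewrite slack_seg; apply: ltr_wpDr.
    by apply: mulr_ge0; [exact: ltW|exact: zI].
  apply: mulr_gt0; [by lra|apply: Ipos].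
  by move: dI; rewrite mem_filter => /andP[].
exists (\dim (U :&: dot_ker c.1)).
  apply: (dim_cap_dot_ker zU).
  have : slack c (x0 + 1 *: (z - x0)) = slack c z.
    by rewrite slack_seg; ring.
  by rewrite slackZ mul1r => e; apply/eqP => e0; move: e zc; rewrite e0; lra.
have wU : w - x0 \in U by rewrite /w addrAC subrr add0r memvZ.
apply: (has_dim_relative_interior (x0 := w)).
  move=> x [[xU _] /= cx]; rewrite memv_cap mem_dot_ker.
  have -> : x - w = (x - x0) - (w - x0) by rewrite opprB addrA subrK.
  rewrite memvB //= opprB addrA subrK dotBr; apply/eqP.
  by move: cx cw; rewrite /slack; lra.
move=> u; rewrite memv_cap mem_dot_ker => /andP[uU /eqP cu].
have [t' /andP[t'0 _] t'P] := exists_small_step u wpos.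
exists t' => //; split; last by rewrite /= slackZ cw cu mulr0 addr0.
split; first by rewrite addrAC memvD // memvZ.
move=> d dI; have [->|dc] := eqVneq d c; first by rewrite slackZ cw cu; lra.
by apply/ltW/t'P; rewrite ?mem_filter ?dc ?lexx ?ltW.
Qed.

Definition face Q c : set (vec R n) := Q `&` [set x | dot c.1 x = c.2].

Lemma faceE Q c x : face Q c x <-> Q x /\ slack c x = 0.
Proof.
rewrite /slack; split=> [[Qx /= ->]|[Qx /eqP]]; first by rewrite subrr.
by rewrite subr_eq0 => /eqP.
Qed.

Lemma valid_slack Q c : valid Q c.1 c.2 <-> forall x, Q x -> 0 <= slack c x.
Proof. by split=> + x Qx => /(_ x Qx); rewrite subr_ge0. Qed.

(** For a full-dimensional polyhedron these are its interior points: only the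
    inequalities with zero normal are exempt from being strict. *)
Definition interior_point Q x :=
  Q x /\ forall c, valid Q c.1 c.2 -> c.1 != 0 -> 0 < slack c x.

Definition describes I Q := forall x, Q x <-> forall c, c \in I -> 0 <= slack c x.

Section Full.
Variables (Q : set (vec R n)) (o : vec R n) (I0 : seq (vec R n * R)).
Hypotheses (Qo : interior_point Q o) (QI0 : describes I0 Q).

Lemma describes_valid I c : describes I Q -> c \in I -> valid Q c.1 c.2.
Proof. by move=> QI cI; apply/valid_slack => x /QI; apply. Qed.

Lemma describes_nonzero I x : describes I Q ->
  (forall c, c \in [seq c <- I | c.1 != 0] -> 0 <= slack c x) -> Q x.
Proof.
move=> QI xI; apply/QI => c cI.
have [c0|c0] := eqVneq c.1 0; last by apply: xI; rewrite mem_filter c0.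
by have /QI/(_ c cI) := Qo.1; rewrite /slack c0 !dot0l.
Qed.

Lemma interior_pos I c : describes I Q ->
  c \in [seq c <- I | c.1 != 0] -> 0 < slack c o.
Proof.
move=> QI; rewrite mem_filter => /andP[c0 cI]; apply: Qo.2 => //.
exact: describes_valid cI.
Qed.

Lemma has_dim_full : has_dim Q (\dim {:vec R n}).
Proof.
apply: (has_dim_relative_interior (x0 := o)) => [x _|u _]; first exact: memvf.
have [t /andP[t0 _] tP] := exists_small_step u (fun c => @interior_pos I0 c QI0).
exists t => //; apply: (describes_nonzero QI0) => c cI.
by apply/ltW/(tP c t cI); rewrite lexx ltW.
Qed.

(** Both the affine hull of a facet and the hyperplane of an inequality that
    defines it have codimension 1, so every affine function vanishing on the facet
    vanishes on the hyperplane. *)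
Lemma facet_direction F c : facet Q F -> defines Q c.1 c.2 F ->
  [/\ c.1 != 0, exists g, F g &
    forall d, (forall x, F x -> slack d x = 0) ->
    forall u, dot c.1 u = 0 -> dot d.1 u = 0].
Proof.
move=> [_ [k [Qk Fk]]] [cv eF].
have kE := has_dim_uniq Qk has_dim_full; rewrite addn1 in kE.
have c0 : c.1 != 0.
  apply/eqP => c0.
  suff FQ : F = Q.
    move: Fk; rewrite FQ => /(has_dim_uniq Qk)/eqP.
    by rewrite addn1 (gtn_eqF (ltnSn _)).
  have [x0 [U [eU _]]] := Fk.
  have /affine_hull_nonempty[g] : affine_hull F x0 by rewrite eU /= subrr mem0v.
  rewrite eF => -[_ /=]; rewrite c0 dot0l => c2.
  by apply/seteqP; split=> [x []//|x Qx]; split=> //=; rewrite dot0l.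
have [x0 [U [eU dU]]] := Fk.
have hx0 : affine_hull F x0 by rewrite eU /= subrr mem0v.
have hU u : u \in U -> affine_hull F (x0 + u).
  by move=> uU; rewrite eU /= addrAC subrr add0r.
have sub d : (forall x, F x -> slack d x = 0) -> (U <= dot_ker d.1)%VS.
  move=> Fd; apply/subvP => u uU; rewrite mem_dot_ker.
  have := affine_hull_slack Fd (hU u uU); have := affine_hull_slack Fd hx0.
  by rewrite /slack dotDr => e1 e2; apply/eqP; lra.
split=> // [|d Fd u cu]; first exact: affine_hull_nonempty hx0.
suff /eqP UE : U == dot_ker c.1.
  by apply/eqP; rewrite -mem_dot_ker; apply: (subvP (sub d Fd)); rewrite UE mem_dot_ker cu.
rewrite eqEdim sub /=; last by move=> x; rewrite eF => /faceE[].
have cc : dot c.1 c.1 != 0.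
  apply: contra c0 => /eqP cc0; apply/eqP/ffunP => e; rewrite ffunE.
  have /psumr_eq0P : forall e : edge n, true -> 0 <= (c.1 e : R) * (c.1 e : R).
    by move=> e' _; rewrite -expr2 sqr_ge0.
  by move=> /(_ cc0 e isT)/eqP; rewrite mulf_eq0 orbb => /eqP.
by have := dim_cap_dot_ker (memvf c.1) cc; rewrite capfv -kE dU => -[->].
Qed.

(** A full-dimensional polyhedron determines the inequality of each of its
    facets up to a positive factor. *)
Lemma facet_proportional F c d :
    facet Q F -> defines Q c.1 c.2 F -> valid Q d.1 d.2 -> d.1 != 0 ->
    (forall x, F x -> slack d x = 0) ->
  exists2 r, 0 < r & forall x, slack d x = r * slack c x.
Proof.
move=> Ff Fc dv d0 Fd; have [c0 [g Fg] dir] := facet_direction Ff Fc.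
have [cv eF] := Fc; have co := Qo.2 c cv c0.
exists (slack d o / slack c o); first by rewrite divr_gt0 ?Qo.2.
(* x is g plus s (o - g) plus a vector parallel to the hyperplane of c, on which
   the functional of d vanishes as well. *)
have [Qg cg] : Q g /\ slack c g = 0 by apply/faceE; rewrite /face -eF.
move=> x; set s := slack c x / slack c o.
have eu (e : vec R n * R) :
    slack e (g + s *: (o - g)) + dot e.1 (x - (g + s *: (o - g))) = slack e x.
  by rewrite /slack dotBr; lra.
have sc : s * slack c o = slack c x by rewrite /s divfK // gt_eqF.
have cu : dot c.1 (x - (g + s *: (o - g))) = 0.
  by have := eu c; rewrite slack_seg cg sc; lra.
have := eu d; rewrite slack_seg (Fd g Fg) (dir d Fd _ cu) -sc => <-.
by field; rewrite gt_eqF.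
Qed.

Lemma facet_defined F c d :
    facet Q F -> defines Q c.1 c.2 F -> valid Q d.1 d.2 -> d.1 != 0 ->
    (forall x, F x -> slack d x = 0) -> defines Q d.1 d.2 F.
Proof.
move=> Ff Fc dv d0 Fd; split=> //.
have [r r0 rP] := facet_proportional Ff Fc dv d0 Fd.
rewrite Fc.2; apply/seteqP; split=> x /faceE[Qx sx]; apply/faceE; split=> //.
  by rewrite rP sx mulr0.
by apply/eqP; rewrite -(mulrI_eq0 _ (lregP (lt0r_neq0 r0))) -rP sx.
Qed.

End Full.

End Polyhedra.

(** * Visible facets and ridges *)

Lemma ltn_count (T : eqType) (P P' : pred T) (s : seq T) x :
  subpred P P' -> x \in s -> P' x -> ~~ P x -> (count P s < count P' s)%N.
Proof.
move=> PP' + P'x nPx; elim: s => //= y s IH; rewrite inE => /orP[/eqP <-|/IH lt].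
  by rewrite P'x (negPf nPx) ltnS sub_count.
by rewrite -addnS leq_add //; case: (boolP (P y)) => // /PP' ->.
Qed.

Section Polyhedra2.
Variables (R : realType) (n : nat).
Implicit Types (x y z a u g : vec R n) (c d : vec R n * R) (t : R).
Implicit Types (A X Q F G : set (vec R n)) (I J : seq (vec R n * R)).
Implicit Types (U : {vspace vec R n}).

Definition midpoint_closed X :=
  forall x y, X x -> X y -> X (x + 2^-1 *: (y - x)).

(** Midpoints with a witness for each inequality in turn make all of them strict. *)
Lemma exists_strict_point X J x0 :
    midpoint_closed X -> X x0 ->
    (forall c, c \in J -> valid X c.1 c.2 /\ exists2 x, X x & 0 < slack c x) ->
  exists2 x, X x & forall c, c \in J -> 0 < slack c x.
Proof.
move=> mX Xx0; elim: J => [|c J IH] JX; first by exists x0.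
have [|x Xx xJ] := IH; first by move=> d dJ; apply: JX; rewrite inE dJ orbT.
have [cX [z Xz cz]] := JX c (mem_head _ _).
exists (x + 2^-1 *: (z - x)) => [|d dJ]; first exact: mX.
have sX e : e \in c :: J -> forall v, X v -> 0 <= slack e v.
  by move=> /JX[/valid_slack].
have := sX d dJ x Xx; have := sX d dJ z Xz; rewrite slack_seg.
move: dJ; rewrite inE => /orP[/eqP -> | /xJ]; lra.
Qed.

Lemma face_midpoint_closed Q I c :
  describes I Q -> midpoint_closed (face Q c).
Proof.
move=> QI x y /faceE[Qx cx] /faceE[Qy cy]; apply/faceE; split.
  apply/QI => d dI; have := (QI x).1 Qx d dI; have := (QI y).1 Qy d dI.
  by rewrite slack_seg; lra.
by rewrite slack_seg cx cy; ring.
Qed.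

Section Full.
Variables (Q : set (vec R n)) (o : vec R n) (I0 : seq (vec R n * R)).
Hypotheses (Qo : interior_point Q o) (QI0 : describes I0 Q).

Lemma defines_face c : valid Q c.1 c.2 -> defines Q c.1 c.2 (face Q c).
Proof. by split. Qed.

Lemma facet_nonzero c : valid Q c.1 c.2 -> facet Q (face Q c) -> c.1 != 0.
Proof.
by move=> cv cF; have [] := facet_direction Qo QI0 cF (defines_face cv).
Qed.

Lemma defining_inequality_unique c d :
    valid Q c.1 c.2 -> facet Q (face Q c) -> defines Q d.1 d.2 (face Q c) ->
  exists2 r, 0 < r & forall x, slack c x = r * slack d x.
Proof.
move=> cv cF dF; apply: (facet_proportional Qo QI0 cF dF cv).
  exact: facet_nonzero.
by move=> x /faceE[].
Qed.

(** A relative interior point of the facet: only multiples of the inequality of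
    the facet can be tight there. *)
Lemma facet_relative_interior c J :
    valid Q c.1 c.2 -> facet Q (face Q c) ->
    (forall d, d \in J -> valid Q d.1 d.2 /\ d.1 != 0) ->
  exists2 g, face Q c g & forall d, d \in J ->
    0 < slack d g \/ exists2 r, 0 < r & forall x, slack d x = r * slack c x.
Proof.
move=> cv cF JV.
have [_ [g0 Fg0] _] := facet_direction Qo QI0 cF (defines_face cv).
set J' := [seq d <- J | `[< exists2 x, face Q c x & 0 < slack d x >]].
have [|g Fg gJ] := exists_strict_point (J := J') (face_midpoint_closed QI0) Fg0.
  move=> d; rewrite mem_filter => /andP[/asboolP dF /JV[dv _]]; split=> //.
  by move=> x [Qx _]; apply: dv.
exists g => // d dJ; have [dF|dF] := pselect (exists2 x, face Q c x & 0 < slack d x).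
  by left; apply: gJ; rewrite mem_filter dJ andbT; apply/asboolP.
have [dv d0] := JV d dJ.
right; apply: (facet_proportional Qo QI0 cF (defines_face cv) dv d0) => x Fx.
apply: le_anti; rewrite (iffLR (valid_slack _ _) dv) ?andbT; last by case: Fx.
by rewrite leNgt; apply/negP => dx; apply: dF; exists x.
Qed.

Lemma face_proportional c d r :
  0 < r -> (forall x, slack d x = r * slack c x) -> face Q d = face Q c.
Proof.
move=> r0 rP; apply/seteqP; split=> x /faceE[Qx sx]; apply/faceE; split=> //.
  by apply/eqP; rewrite -(mulrI_eq0 _ (lregP (lt0r_neq0 r0))) -rP sx.
by rewrite rP sx mulr0.
Qed.

(** By irredundancy in the whole space, a point outside Q violates one of the
    given inequalities that defines a facet. *)
Lemma exists_facet_description :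
  exists2 I, describes I Q & forall c, c \in I -> facet Q (face Q c).
Proof.
set I := [seq c <- I0 | `[< facet Q (face Q c) >]].
exists I => [x|c]; last by rewrite mem_filter => /andP[/asboolP].
split=> [/QI0 xI c|xI]; first by rewrite mem_filter => /andP[_ /xI].
apply: contrapT => Qx.
set I1 := [seq c <- I0 | c.1 != 0].
have [c cI1|||c [cI1 cx [k kd kF]]] := @cell_facet R n I1 o fullv x.
- exact: (interior_pos Qo QI0).
- exact: memvf.
- by move=> [_ xI1]; apply: Qx; apply: (describes_nonzero Qo QI0) => c; apply: xI1.
have cI0 : c \in I0 by move: cI1; rewrite mem_filter => /andP[].
have cv := describes_valid QI0 cI0.
suff : 0 <= slack c x by lra.
apply: xI; rewrite mem_filter cI0 andbT; apply/asboolP; split.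
  by exists c.1, c.2; exact: defines_face.
exists k; split; first by rewrite addn1 kd; exact: has_dim_full Qo QI0.
congr (has_dim _ k): kF; apply/seteqP; split=> y.
  move=> [[_ yI1] cy]; apply/faceE; split=> //.
  by apply: (describes_nonzero Qo QI0) => d; apply: yI1.
move=> /faceE[Qy cy]; split=> //; split=> [|d]; first exact: memvf.
by rewrite mem_filter => /andP[_ dI0]; apply/(QI0 y).1.
Qed.

Section Walk.
Variables (I : seq (vec R n * R)).
Hypotheses (QI : describes I Q) (IF : forall c, c \in I -> facet Q (face Q c)).

Lemma description_valid c : c \in I -> valid Q c.1 c.2 /\ c.1 != 0.
Proof.
move=> cI; have cv := describes_valid QI cI; split=> //.
exact: facet_nonzero cv (IF cI).
Qed.

(** Irredundancy inside the hyperplane of the facet: its own facets are the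
    ridges of Q on it. *)
Lemma facet_exit_ridge c x :
    c \in I -> slack c x = 0 -> ~ Q x ->
  exists2 d, d \in I & slack d x < 0 /\ has_codim Q (face Q c `&` face Q d) 2.
Proof.
move=> cI cx Qx; have [cv c0] := description_valid cI.
have [g Fg gI] := facet_relative_interior cv (IF cI) description_valid.
have /faceE[Qg cg] := Fg.
set J := [seq d <- I | 0 < slack d g].
have JQ y : slack c y = 0 -> (forall d, d \in J -> 0 <= slack d y) -> Q y.
  move=> cy yJ; apply/QI => d dI; have [dg|[r _ ->]] := gI d dI.
    by apply: yJ; rewrite mem_filter dg.
  by rewrite cy mulr0.
have kerE y : (y - g \in dot_ker c.1) = (slack c y == 0).
  by rewrite mem_dot_ker dotBr; move: cg; rewrite /slack => cg; apply/eqP/eqP; lra.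
have [d||| d [dJ dx [k kd kF]]] := @cell_facet R n J g (dot_ker c.1) x.
- by rewrite mem_filter => /andP[].
- by rewrite kerE cx.
- by move=> [_ xJ]; apply/Qx/JQ.
exists d; first by move: dJ; rewrite mem_filter => /andP[].
split=> //; exists k; split.
  have := has_dim_full Qo QI0; congr (has_dim Q _).
  have oc : dot c.1 (o - g) != 0.
    have := Qo.2 c cv c0; move: cg; rewrite dotBr /slack => cg co.
    by apply/eqP; lra.
  by have := dim_cap_dot_ker (memvf (o - g)) oc; rewrite capfv -kd addn2.
congr (has_dim _ k): kF; apply/seteqP; split=> y.
  move=> [[/= yk yJ] dy]; have /eqP cy : slack c y == 0 by rewrite -kerE.
  by have Qy := JQ y cy yJ; split; apply/faceE.
move=> [/faceE[Qy cy] /faceE[_ dy]]; split=> //; split; first by rewrite kerE cy.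
by move=> e; rewrite mem_filter => /andP[_ eI]; apply/(QI y).1.
Qed.

(** Induction on the number of visible facets whose hyperplanes the segment
    from g to y meets before that of c, where g is a relative interior point of
    the facet of c0. *)
Lemma visible_facets_connected (V : set (set (vec R n))) y c c0 :
    (forall d, d \in I -> slack d y < 0 -> V (face Q d)) ->
    c \in I -> slack c y < 0 -> c0 \in I -> slack c0 y < 0 ->
  clos_refl_trans _ (fun X Y => [/\ V X, V Y &
      [/\ facet Q X, facet Q Y & has_codim Q (X `&` Y) 2]])
    (face Q c) (face Q c0).
Proof.
move=> yV + + c0I c0y; have [c0v _] := description_valid c0I.
have [g Fg gI] := facet_relative_interior c0v (IF c0I) description_valid.
have /faceE[Qg c0g] := Fg.
have gpos d : d \in I -> 0 <= slack d g by move=> dI; apply/(QI g).1.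
(* where the segment from g to y crosses the hyperplane of d *)
pose s d := slack d g / (slack d g - slack d y).
have [m] := ubnP (count (fun d => (slack d y < 0) && (s d < s c)) I).
elim: m c => // m IH c; rewrite ltnS => cm cI cy.
have [cg|cg0] := eqVneq (slack c g) 0.
  have [|[r r0 rP]] := gI c cI; first by rewrite cg ltxx.
  rewrite (face_proportional r0 rP); exact: rt_refl.
have cg : 0 < slack c g by rewrite lt_neqAle eq_sym cg0 gpos.
have D0 : 0 < slack c g - slack c y by lra.
have sc0 : 0 < s c by rewrite divr_gt0.
have sc1 : s c < 1 by rewrite /s ltr_pdivrMr // mul1r; lra.
set x := g + s c *: (y - g).
have cx : slack c x = 0 by rewrite slack_seg /s; field; rewrite gt_eqF.
have Qx : ~ Q x.
  move=> /QI/(_ c0 c0I); rewrite slack_seg c0g mulr0 add0r.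
  by rewrite pmulr_rge0 // leNgt c0y.
have [d dI [dx cdQ]] := facet_exit_ridge cI cx Qx.
have dg := gpos d dI.
have sdg : 0 <= (1 - s c) * slack d g by apply: mulr_ge0; lra.
have dy : slack d y < 0.
  rewrite ltNge; apply/negP => dy; have := mulr_ge0 (ltW sc0) dy.
  by move: dx; rewrite slack_seg; lra.
have sd : s d < s c.
  rewrite {1}/s ltr_pdivrMr; last by lra.
  by move: dx; rewrite slack_seg; lra.
apply: rt_trans (rt_step _ _ _ _ _) (IH d _ dI dy).
  by split; [exact: yV|exact: yV|split; [exact: IF|exact: IF|]].
apply: leq_trans cm; apply: (@ltn_count _ _ _ _ d) => //=.
- by move=> e /andP[-> /lt_trans]; apply.
- by rewrite dy.
- by rewrite ltxx andbF.
Qed.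

End Walk.
End Full.

End Polyhedra2.

(** * Finitely generated cones and convex hulls *)

Section Cones.
Variables (R : realType) (n : nat).
Implicit Types (x y : vec R n) (c d : vec R n * R) (s t a b : R).
Implicit Types (G J : seq (vec R n * R)).

(** The homogenization of [slack]: [hslack c x 1 = slack c x]. *)
Definition hslack c x s : R := dot c.1 x - c.2 * s.

(** The pairs (x, s) that are non-negative combinations of the pairs in G, with
    one coefficient per element of G, so that coefficients can be eliminated one
    at a time. *)
Fixpoint cone (G : seq (vec R n * R)) x s : Prop :=
  if G is g :: G' then exists2 t, 0 <= t & cone G' (x - t *: g.1) (s - t * g.2)
  else x = 0 /\ s = 0.

Lemma cone0 G : cone G 0 0.
Proof.
by elim: G => //= g G IH; exists 0; rewrite // scale0r mul0r !subr0.
Qed.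

Lemma cone_comb G x y s t a b : 0 <= a -> 0 <= b ->
  cone G x s -> cone G y t -> cone G (a *: x + b *: y) (a * s + b * t).
Proof.
move=> a0 b0; elim: G x y s t => [|g G IH] x y s t /=.
  by move=> [-> ->] [-> ->]; rewrite !scaler0 !mulr0 !addr0.
move=> [k k0 xG] [l l0 yG]; exists (a * k + b * l).
  by rewrite addr_ge0 ?mulr_ge0.
have := IH _ _ _ _ xG yG; congr cone; last by ring.
by rewrite !scalerBr !scalerA scalerDl opprD addrACA.
Qed.

Lemma cone_add G x y s t : cone G x s -> cone G y t -> cone G (x + y) (s + t).
Proof.
by move=> xG yG; have := cone_comb ler01 ler01 xG yG; rewrite !scale1r !mul1r.
Qed.

Lemma cone_mem G g : g \in G -> cone G g.1 g.2.
Proof.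
elim: G => //= h G IH; rewrite inE => /orP[/eqP ->|/IH gG].
  by exists 1; rewrite // scale1r mul1r !subrr; exact: cone0.
by exists 0; rewrite // scale0r mul0r !subr0.
Qed.

(** Fourier-Motzkin elimination of the coefficient t of the ray g.  Each
    inequality bounds t from above or from below according to the sign of its
    value at g, and a common t exists as soon as every lower bound is at most
    every upper bound. *)
Lemma polyhedral_add_ray J g : exists J', forall x s,
  (forall c, c \in J' -> 0 <= hslack c x s) <->
  exists2 t, 0 <= t & forall c, c \in J -> 0 <= hslack c (x - t *: g.1) (s - t * g.2).
Proof.
pose k c := hslack c g.1 g.2.
have kE c x s t : hslack c (x - t *: g.1) (s - t * g.2) = hslack c x s - t * k c.
  by rewrite /k /hslack dotBr dotZr; ring.
pose elim2 c d := (k c *: d.1 - k d *: c.1, k c * d.2 - k d * c.2).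
have elimE c d x s : hslack (elim2 c d) x s = k c * hslack d x s - k d * hslack c x s.
  by rewrite /hslack /elim2 /= dotDl -scaleNr !dotZl; ring.
exists ([seq c <- J | 0 <= k c] ++
  [seq elim2 c d | c <- [seq c <- J | 0 < k c], d <- [seq d <- J | k d < 0]]).
move=> x s; split=> [xJ'|[t t0 tJ] c].
  have xJ c : c \in J -> 0 <= k c -> 0 <= hslack c x s.
    by move=> cJ ck; apply: xJ'; rewrite mem_cat mem_filter ck cJ.
  (* the largest lower bound on the coefficient *)
  set t := \big[Num.max/0]_(d <- J | k d < 0) (hslack d x s / k d).
  exists t; first by rewrite /t; apply: bigmax_ge_id.
  move=> c cJ; rewrite kE.
  have [kc|kc|kc] := ltgtP (k c) 0; last by rewrite kc mulr0 subr0 xJ ?kc.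
    have : hslack c x s / k c <= t.
      exact: (@le_bigmax_seq _ _ _ _ 0 c (fun d => k d < 0) (fun d => hslack d x s / k d) cJ kc).
    by rewrite ler_ndivrMr //; lra.
  suff : t <= hslack c x s / k c by rewrite ler_pdivlMr //; lra.
  rewrite /t big_seq_cond; apply: bigmax_le.
    by rewrite divr_ge0 ?xJ // ltW.
  move=> d /andP[dJ kd]; rewrite ler_pdivlMr // mulrAC ler_ndivrMr //.
  have : 0 <= hslack (elim2 c d) x s.
    apply: xJ'; rewrite mem_cat; apply/orP; right; apply/allpairsP; exists (c, d).
    by rewrite !mem_filter /= kc kd cJ dJ.
  by rewrite elimE; lra.
rewrite mem_cat mem_filter => /orP[/andP[ck cJ]|/allpairsP[[c1 c2] /=]].
  by have := tJ c cJ; rewrite kE; have := mulr_ge0 t0 ck; lra.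
rewrite !mem_filter => -[/andP[k1 c1J] /andP[k2 c2J] ->]; rewrite elimE.
have := tJ _ c1J; have := tJ _ c2J; rewrite !kE => h2 h1.
have := mulr_ge0 (ltW k1) h2.
have k2' : 0 <= - k c2 by lra.
have := mulr_ge0 k2' h1; lra.
Qed.

Lemma cone_polyhedral G : exists J, forall x s,
  (forall c, c \in J -> 0 <= hslack c x s) <-> cone G x s.
Proof.
elim: G => [|g G [J JG]].
  exists ([seq (unit_vec R e, 0) | e <- enum {: edge n}] ++
    [seq (- unit_vec R e, 0) | e <- enum {: edge n}] ++ [:: (0, 1); (0, -1)]).
  move=> x s; split=> [xJ|[-> ->] c _]; last first.
    by rewrite /hslack dot0r mulr0 subr0.
  split; last first.
    have h c : c \in [:: (0, 1); (0, -1)] -> 0 <= hslack c x s.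
      by move=> cJ; apply: xJ; rewrite !mem_cat cJ !orbT.
    have := h (0, 1); have := h (0, -1).
    rewrite /hslack /= !inE !eqxx orbT /= !dot0l => /(_ isT) h1 /(_ isT) h2.
    by apply/eqP; rewrite eq_le; apply/andP; split; lra.
  apply/ffunP => e; rewrite ffunE; apply/eqP; rewrite eq_le; apply/andP; split.
    have := xJ (- unit_vec R e, 0); rewrite !mem_cat map_f ?mem_enum // orbT.
    move=> /(_ isT); rewrite /hslack /= mul0r subr0 dotC dotNr dot_unit.
    by rewrite oppr_ge0.
  have := xJ (unit_vec R e, 0); rewrite !mem_cat map_f ?mem_enum //.
  by move=> /(_ isT); rewrite /hslack /= mul0r subr0 dotC dot_unit.
have [J' J'P] := polyhedral_add_ray J g; exists J' => x s.
split=> [/J'P[t t0 /JG tG]|[t t0 /JG tG]]; first by exists t.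
by apply/J'P; exists t.
Qed.

End Cones.

Section Hull.
Variables (R : realType) (n : nat).
Implicit Types (x y : vec R n) (t : R) (A X : set (vec R n)).

Lemma convex_hull_gen A x : A x -> convex_hull A x.
Proof. by move=> Ax; apply: sub_gen_smallest. Qed.

Lemma convex_hull_min A X :
    (forall x y t, 0 < t < 1 -> X x -> X y -> X (t *: x + (1 - t) *: y)) ->
  A `<=` X -> convex_hull A `<=` X.
Proof.
move=> cX AX; apply: smallest_sub => //; apply/convex_setW => x y.
rewrite !inE => Xx Xy k k0 k1; rewrite inE.
by apply: cX => //; rewrite k0 k1.
Qed.

Lemma convex_hull_conv A x y t : 0 <= t <= 1 ->
  convex_hull A x -> convex_hull A y -> convex_hull A (t *: x + (1 - t) *: y).
Proof.
move=> /andP[t0 t1] hx hy X [cX AX].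
have := cX x y (Itv01 t0 t1); rewrite !inE; apply.
  by apply: hx.
by apply: hy.
Qed.

End Hull.

(** * The polyhedron P is described by finitely many inequalities *)

Section Multigraphs.
Variable n : nat.
Implicit Types (m : edge n -> nat) (u v : 'I_n).

Lemma mg_connected_sub m m' :
  (forall e, (0 < m e)%N -> (0 < m' e)%N) -> mg_connected m -> mg_connected m'.
Proof.
move=> mm' mC u v; apply: connect_sub (mC u v) => s t /existsP[e /andP[eE me]].
by apply/connect1/existsP; exists e; rewrite eE mm'.
Qed.

Lemma mg_even_odd m m' :
  (forall e, odd (m e) = odd (m' e)) -> mg_even m -> mg_even m'.
Proof.
have oddS (P : pred (edge n)) f :
    odd (\sum_(e | P e) f e)%N = \big[addb/false]_(e | P e) odd (f e).
  exact: (big_morph odd oddD).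
by move=> mm' mE u; rewrite oddS -(eq_bigr _ (fun e _ => mm' e)) -oddS.
Qed.

(** Removing an even number of copies of an edge, but never all of them, preserves
    connectedness and parities; only finitely many multigraphs are left. *)
Definition trim_mult m (e : edge n) : nat := if m e is k.+1 then (odd k).+1 else 0%N.

Lemma trim_multE m e : m e = (trim_mult m e + ((m e).-1)./2.*2)%N.
Proof.
by rewrite /trim_mult; case: (m e) => //= k; rewrite -[in LHS](odd_double_half k).
Qed.

Lemma trim_mult_lt3 m e : (trim_mult m e < 3)%N.
Proof. by rewrite /trim_mult; case: (m e) => //= k; case: odd. Qed.

Lemma trim_mult_tour m : mg_connected m -> mg_even m ->
  mg_connected (trim_mult m) /\ mg_even (trim_mult m).
Proof.
move=> mC mE; split.
  by apply: mg_connected_sub mC => e; rewrite /trim_mult; case: (m e).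
by apply: mg_even_odd mE => e; rewrite [in LHS]trim_multE oddD odd_double addbF.
Qed.

Lemma const2_tour : mg_connected (fun _ : edge n => 2%N) /\ mg_even (fun _ : edge n => 2%N).
Proof.
split; last by move=> u; rewrite sum_nat_const muln2 odd_double.
move=> u v; have [->|uv] := eqVneq u v; first exact: connect0.
have c2 : #|[set u; v]%SET| == 2%N by rewrite cards2 uv.
by apply/connect1/existsP; exists (exist _ [set u; v]%SET c2); rewrite /= eqxx.
Qed.

End Multigraphs.

Section Gtsp.
Variables (R : realType) (n : nat).
Implicit Types (m : edge n -> nat) (x y w : vec R n) (s t : R) (c : vec R n * R).
Local Notation P := (gtsp R n).

Definition mult_vec m : vec R n := [ffun e => (m e)%:R].

Lemma gtsp_tour m : mg_connected m -> mg_even m -> P (mult_vec m).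
Proof. by move=> mC mE; apply: convex_hull_gen; exists m. Qed.

Lemma gtsp_min (X : set (vec R n)) :
    (forall x y t, 0 < t < 1 -> X x -> X y -> X (t *: x + (1 - t) *: y)) ->
    (forall m, mg_connected m -> mg_even m -> X (mult_vec m)) ->
  P `<=` X.
Proof. by move=> cX gX; apply: convex_hull_min => // _ [m [mC mE ->]]; apply: gX. Qed.

Lemma gtsp_conv x y t : 0 <= t <= 1 -> P x -> P y -> P (t *: x + (1 - t) *: y).
Proof. exact: convex_hull_conv. Qed.

(** Adding an even number of copies of e to a tour gives a tour, so moving in the
    direction of e from a tour stays on a segment between two tours. *)
Lemma gtsp_add_unit x e t : 0 <= t -> P x -> P (x + t *: unit_vec R e).
Proof.
move=> + Px; move: x Px t.
apply: (@gtsp_min (fun x => forall t, 0 <= t -> P (x + t *: unit_vec R e))).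
  move=> x y s /andP[s0 s1] xP yP t t0.
  have -> : s *: x + (1 - s) *: y + t *: unit_vec R e =
      s *: (x + t *: unit_vec R e) + (1 - s) *: (y + t *: unit_vec R e).
    by rewrite !scalerDr addrACA -scalerDl addrCA subrr addr0 scale1r.
  by apply: gtsp_conv; [rewrite !ltW|exact: xP|exact: yP].
move=> m mC mE t t0.
pose k := Num.bound t; have tk : t < k%:R by have := archi_boundP t0.
pose m' f := (m f + (k * (f == e)).*2)%N.
have Pm' : P (mult_vec m').
  apply: gtsp_tour.
    by apply: mg_connected_sub mC => f; rewrite /m'; case: (m f).
  by apply: mg_even_odd mE => f; rewrite oddD odd_double addbF.
have k0 : 0 < k%:R :> R by apply: le_lt_trans tk.
have -> : mult_vec m + t *: unit_vec R e =
    (t / k%:R / 2) *: mult_vec m' + (1 - t / k%:R / 2) *: mult_vec m.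
  apply/ffunP => f; rewrite !ffunE /m' natrD -muln2 !natrM /GRing.scale /=.
  by field; rewrite gt_eqF.
apply: gtsp_conv Pm' (gtsp_tour mC mE).
have r0 : 0 <= t / k%:R by rewrite divr_ge0 // ltW.
have : t / k%:R < 1 by rewrite ltr_pdivrMr // mul1r.
lra.
Qed.

Lemma vec_sum_unit x : x = \sum_e (x e : R) *: unit_vec R e.
Proof.
apply/ffunP => f; rewrite -[LHS]dot_unit -[RHS]dot_unit [RHS]dotC dot_sumr.
by apply: eq_bigr => e _; rewrite dotZr dot_unit.
Qed.

Lemma gtsp_add_nonneg x w : (forall e, 0 <= (w e : R)) -> P x -> P (x + w).
Proof.
move=> w0 Px; rewrite [w]vec_sum_unit.
elim: (index_enum _) => [|e s IH]; first by rewrite big_nil addr0.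
by rewrite big_cons addrCA addrC; apply: gtsp_add_unit.
Qed.

(** Generators of the cone over P: points of P sit at height 1, and the recession
    directions of P at height 0. *)
Definition tour_rays : seq (vec R n * R) :=
  [seq (mult_vec (fun e => f e), 1) | f : {ffun edge n -> 'I_3} <-
    [seq f : {ffun edge n -> 'I_3} <- enum {: {ffun edge n -> 'I_3}} |
    `[< mg_connected (fun e => f e : nat) /\ mg_even (fun e => f e : nat) >]]] ++
  [seq (unit_vec R e, 0) | e <- enum {: edge n}].

Lemma tour_raysP g : g \in tour_rays ->
  (P g.1 /\ g.2 = 1) \/ ((forall e, 0 <= (g.1 e : R)) /\ g.2 = 0).
Proof.
rewrite mem_cat => /orP[/mapP[f + ->]|/mapP[e _ ->]] /=.
  by rewrite mem_filter => /andP[/asboolP[fC fE] _]; left; split; first exact: gtsp_tour.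
by right; split=> // f; rewrite ffunE ler0n.
Qed.

Lemma cone_units x : (forall e, 0 <= (x e : R)) -> cone tour_rays x 0.
Proof.
move=> x0; rewrite [x]vec_sum_unit.
elim: (index_enum _) => [|e s IH]; first by rewrite big_nil; exact: cone0.
have eG : (unit_vec R e, 0) \in tour_rays.
  by rewrite mem_cat orbC map_f // mem_enum.
have := cone_comb (x0 e) ler01 (cone_mem eG) IH.
by rewrite big_cons scale1r /= mulr0 mulr0 addr0.
Qed.

Lemma cone_gtsp G x s :
    (forall g, g \in G ->
      (P g.1 /\ g.2 = 1) \/ ((forall e, 0 <= (g.1 e : R)) /\ g.2 = 0)) ->
  cone G x s ->
  0 <= s /\ exists p w, [/\ P p, forall e, 0 <= (w e : R) & x = s *: p + w].
Proof.
elim: G x s => [|g G IH] x s GP /=.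
  move=> [-> ->]; split=> //; have [c2C c2E] := const2_tour n.
  exists (mult_vec (fun=> 2%N)), 0; split; first exact: gtsp_tour.
    by move=> e; rewrite ffunE.
  by rewrite scale0r addr0.
move=> [t t0 /IH[h hG|s0 [p [w [Pp w0 xE]]]]]; first by apply: GP; rewrite inE hG orbT.
have xE' : x = t *: g.1 + (s - t * g.2) *: p + w.
  by rewrite -addrA -xE addrC subrK.
have [[Pg g1]|[g0 g2]] := GP g (mem_head _ _).
  rewrite g1 mulr1 in s0 xE'; have ss : 0 <= s by lra.
  split=> //; have [sE|sn0] := eqVneq s 0.
    have tE : t = 0 by lra.
    by exists p, w; split=> //; rewrite xE' sE tE subrr !scale0r addr0.
  have sp : 0 < s by rewrite lt_neqAle eq_sym sn0.
  exists ((t / s) *: g.1 + (1 - t / s) *: p), w; split=> //.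
    apply: gtsp_conv Pg Pp; rewrite divr_ge0 // ler_pdivrMr // mul1r.
    by lra.
  rewrite xE' scalerDr !scalerA; congr (_ *: _ + _ *: _ + _); field; exact: sn0.
rewrite g2 mulr0 subr0 in s0 xE'; split=> //; exists p, (t *: g.1 + w); split=> //.
  by move=> e; rewrite !ffunE addr_ge0 // mulr_ge0.
by rewrite xE' addrAC addrC.
Qed.

Lemma gtsp_cone x : P x <-> cone tour_rays x 1.
Proof.
split=> [|/(cone_gtsp tour_raysP)[_ [p [w [Pp w0 ->]]]]]; last first.
  by rewrite scale1r; apply: gtsp_add_nonneg.
move: x; apply: gtsp_min => [x y t /andP[t0 t1] xG yG|m mC mE].
  have t1' : 0 <= 1 - t by lra.
  by have := cone_comb (ltW t0) t1' xG yG; rewrite !mulr1 [t + _]addrC subrK.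
have [tC tE] := trim_mult_tour mC mE.
have -> : mult_vec m = mult_vec (trim_mult m) +
    [ffun e => (((m e).-1)./2.*2)%:R].
  by apply/ffunP => e; rewrite !ffunE -natrD -trim_multE.
rewrite -[X in cone _ _ X]addr0; apply: cone_add; last first.
  by apply: cone_units => e; rewrite ffunE ler0n.
pose f : {ffun edge n -> 'I_3} := [ffun e => Ordinal (trim_mult_lt3 m e)].
have fE : trim_mult m = (fun e => f e : nat) by apply/funext => e; rewrite ffunE.
rewrite fE in tC tE *.
apply: (@cone_mem _ _ _ (mult_vec (fun e => f e), 1)).
rewrite mem_cat; apply/orP; left; apply/mapP; exists f => //.
by rewrite mem_filter mem_enum andbT; apply/asboolP.
Qed.

Lemma gtsp_polyhedral : exists I, describes I P.
Proof.
have [J JP] := cone_polyhedral tour_rays; exists J => x.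
rewrite gtsp_cone -JP /hslack /slack.
by split=> xJ c /xJ; rewrite mulr1.
Qed.

(** P is closed under adding non-negative vectors, so the normal of a valid
    inequality is non-negative, and adding 1 to all entries of a point of P makes
    every such inequality strict. *)
Lemma gtsp_interior : exists o, interior_point P o.
Proof.
have [c2C c2E] := const2_tour n.
pose p := mult_vec (fun=> 2%N); have Pp : P p by exact: gtsp_tour.
exists (p + [ffun=> 1]); split=> [|c /valid_slack cv c0].
  by apply: gtsp_add_nonneg => // e; rewrite ffunE.
have cge e : 0 <= (c.1 e : R).
  rewrite leNgt; apply/negP => ce.
  have cp := cv p Pp.
  (* so many copies of e would make the slack equal to -1 *)
  have t0 : 0 <= (slack c p + 1) / - (c.1 e : R) by rewrite divr_ge0 //; lra.
  have := cv _ (gtsp_add_unit e t0 Pp); rewrite slackZ dot_unit.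
  have -> : (slack c p + 1) / - (c.1 e : R) * c.1 e = - (slack c p + 1).
    by field; rewrite lt_eqF.
  lra.
have [e ce] : exists e, (c.1 e : R) != 0.
  apply: contrapT => ce; case/eqP: c0; apply/ffunP => e; rewrite ffunE.
  by apply/eqP/negPn/negP => ce'; apply: ce; exists e.
have : 0 < dot c.1 [ffun=> 1 : R^o].
  rewrite /dot (bigD1 e) //= ffunE mulr1 ltr_pwDl ?lt_neqAle 1?eq_sym ?ce ?cge //.
  by apply: sumr_ge0 => f _; rewrite ffunE mulr1.
by have := cv p Pp; rewrite /slack dotDr; lra.
Qed.

End Gtsp.

(** * Hamilton cycles *)

Lemma next_next_neq (T : eqType) (p : seq T) x : uniq p -> (2 < size p)%N -> x \in p ->
  next p x != x /\ next p (next p x) != x.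
Proof.
move=> pU ps xp; have [i q pq] := rot_to xp.
rewrite -!(next_rot i pU) pq.
have : uniq (x :: q) by rewrite -pq rot_uniq.
have : (2 < size (x :: q))%N by rewrite -pq size_rot.
case: q {pq} => [|y [|z q]] //= _; rewrite !inE !negb_or eqxx.
move=> /andP[/and3P[xy xz _] /andP[/andP[yz _] _]].
by rewrite eq_sym xy (negPf xy) eqxx; split => //; rewrite eq_sym.
Qed.

(** Sums over the edges of a closed walk, in a form that computes on explicit
    sequences. *)
Lemma big_next (T : eqType) (V : nmodType) (p : seq T) (F : T -> T -> V) : uniq p ->
  \sum_(x <- p) F x (next p x) = \sum_(xy <- zip p (rot 1 p)) F xy.1 xy.2.
Proof.
move=> pU; have -> : rot 1 p = map (next p) p.
  case: p pU => // x s pU; rewrite rot1_cons.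
  apply: (@eq_from_nth _ x) => [|i]; first by rewrite size_rcons size_map.
  rewrite size_rcons => si; rewrite (nth_map x) // next_nth mem_nth //.
  rewrite index_uniq // nth_rcons; case: ltngtP => // [|->]; last by rewrite nth_default.
  by rewrite ltnNge -ltnS si.
have -> : forall s : seq T, zip s (map (next p) s) = [seq (x, next p x) | x <- s].
  by elim=> //= x s ->.
by rewrite big_map.
Qed.

Lemma set2_eqP (T : finType) (a b c d : T) : [set a; b]%SET = [set c; d]%SET ->
  (a = c /\ b = d) \/ (a = d /\ b = c).
Proof.
move=> e; have := set21 a b; have := set22 a b; rewrite e => /set2P aP /set2P bP.
have := set21 c d; have := set22 c d; rewrite -e; move: aP bP.
case=> ?; case=> ?; do 2!case/set2P=> ?; by [left; split; congruence|right; split; congruence].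
Qed.

Section PairVectors.
Variables (R : realType) (n : nat).
Implicit Types (u v w : 'I_n) (e : edge n) (p : seq 'I_n).

(** The characteristic vector of the edge uv; it is 0 when u = v. *)
Definition pair_vec u v : vec R n := [ffun e => (val e == [set u; v]%SET)%:R].

Lemma pair_vecC u v : pair_vec u v = pair_vec v u.
Proof. by apply/ffunP => e; rewrite !ffunE finset.setUC. Qed.

Lemma pair_vec_unit e u v : val e = [set u; v]%SET -> pair_vec u v = unit_vec R e.
Proof. by move=> eE; apply/ffunP => f; rewrite !ffunE -eE val_eqE. Qed.

Lemma edge_ends e : exists u v, u != v /\ val e = [set u; v]%SET.
Proof. exact/cards2P/(valP e). Qed.

Lemma edge_neq e u v : val e = [set u; v]%SET -> u != v.
Proof. by move=> eE; have := valP e; rewrite eE /= cards2; case: (u != v). Qed.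

Lemma edge_exists u v : u != v -> exists e : edge n, val e = [set u; v]%SET.
Proof.
move=> uv; have c2 : #|[set u; v]%SET| == 2%N by rewrite cards2 uv.
by exists (exist _ [set u; v]%SET c2).
Qed.

Lemma delta_pair u v w : v != w ->
  dot (delta R u) (pair_vec v w) = 2^-1 * ((u == v)%:R + (u == w)%:R).
Proof.
move=> vw; have [e eE] := edge_exists vw.
rewrite (pair_vec_unit eE) dot_unit ffunE eE !inE.
case: (eqVneq u v) => [->|uv] /=; first by rewrite (negPf vw) addr0 mulr1.
by case: (u == w); rewrite add0r ?mulr1 ?mulr0.
Qed.

Lemma delta_mult u (m : edge n -> nat) :
  dot (delta R u) (mult_vec R m) = 2^-1 * (\sum_(e : edge n | u \in val e) m e)%N%:R.
Proof.
rewrite /dot natr_sum mulr_sumr [RHS]big_mkcond; apply: eq_bigr => e _.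
by rewrite !ffunE; case: ifP; rewrite ?mul0r.
Qed.

Lemma cycle_vec p : uniq p -> (2 < size p)%N ->
  char_vec R (cycle_edges p) = \sum_(u <- p) pair_vec u (next p u).
Proof.
move=> pU ps; apply/ffunP => e; rewrite sum_ffunE ffunE inE.
case: existsP => [[u /andP[up /eqP eE]]|ne].
  rewrite (bigD1_seq u) //= ffunE eE eqxx big1_seq ?addr0 // => v /andP[vu vp].
  rewrite ffunE eE; case: eqP => // /set2_eqP[[uv _]|[uv vu']].
    by rewrite uv eqxx in vu.
  by have [_] := next_next_neq pU ps up; rewrite vu' -uv eqxx.
rewrite big1_seq // => u /andP[_ up]; rewrite ffunE; case: eqP => // eE.
by case: ne; exists u; rewrite up eE eqxx.
Qed.

Section HamiltonCycle.
Variable p : seq 'I_n.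
Hypotheses (n_gt2 : (2 < n)%N) (pU : uniq p) (pT : p =i 'I_n).

Lemma tour_size : size p = n.
Proof. by rewrite -(card_uniqP pU) (eq_card pT) card_ord. Qed.

Lemma tour_mem u : u \in p. Proof. by rewrite pT. Qed.

Lemma next_neq u : u != next p u.
Proof. by rewrite eq_sym; case: (@next_next_neq _ p u); rewrite ?tour_size ?tour_mem. Qed.

Lemma delta_tour u : dot (delta R u) (char_vec R (cycle_edges p)) = 1.
Proof.
rewrite cycle_vec ?tour_size // dot_sumr.
rewrite (eq_bigr _ (fun v _ => delta_pair u (next_neq v))) -mulr_sumr big_split /=.
rewrite (bigD1_seq u) ?tour_mem //= eqxx big1 ?addr0; last first.
  by move=> v vu; rewrite eq_sym (negPf vu).
rewrite (bigD1_seq (prev p u)) ?tour_mem //= next_prev // eqxx big1 ?addr0.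
  by rewrite mulVf ?pnatr_eq0.
by move=> v vu; case: (eqVneq u (next p v)) => // uv; move: vu; rewrite uv prev_next // eqxx.
Qed.

Lemma tour_char_mult :
  char_vec R (cycle_edges p) = mult_vec R (fun e => e \in cycle_edges p : nat).
Proof. by apply/ffunP => e; rewrite !ffunE. Qed.

Lemma tour_connected : mg_connected (fun e => e \in cycle_edges p : nat).
Proof.
move=> u v; have : fconnect (next p) u v.
  by rewrite (fconnect_cycle (cycle_next pU)) ?tour_mem.
apply: connect_sub => s t /eqP <-; apply/connect1/existsP.
have [e eE] := edge_exists (next_neq s); exists e; rewrite eE eqxx lt0b inE.
by apply/existsP; exists s; rewrite tour_mem eE eqxx.
Qed.

Lemma tour_even : mg_even (fun e => e \in cycle_edges p : nat).
Proof.
move=> u; have := delta_tour u; rewrite tour_char_mult delta_mult => deg.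
have -> : (\sum_(e : edge n | u \in val e) (e \in cycle_edges p))%N = 2%N by
  apply/eqP; rewrite -(eqr_nat R); apply/eqP; lra.
by [].
Qed.

Lemma gtsp_tour_vec : gtsp R n (char_vec R (cycle_edges p)).
Proof. by rewrite tour_char_mult; apply: gtsp_tour tour_connected tour_even. Qed.

Lemma stsp_tour_vec : stsp R n (char_vec R (cycle_edges p)).
Proof. by apply: convex_hull_gen; exists (cycle_edges p) => //; exists p. Qed.

End HamiltonCycle.

Lemma stsp_sub_gtsp : (2 < n)%N -> stsp R n `<=` gtsp R n.
Proof.
move=> n2; apply: convex_hull_min => [x y t /andP[t0 t1] Px Py|].
  by apply: gtsp_conv Px Py; rewrite !ltW.
by move=> _ [_ [p [pU pT ->]] ->]; apply: gtsp_tour_vec.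
Qed.

Lemma stsp_delta x u : (2 < n)%N -> stsp R n x -> dot (delta R u) x = 1.
Proof.
move=> n2; move: x; apply: convex_hull_min => [x y t _ Px Py|].
  by rewrite dotDr !dotZr Px Py; ring.
by move=> _ [_ [p [pU pT ->]] ->]; apply: delta_tour.
Qed.

End PairVectors.

(** * The polytope S is the face of P with all degrees tight *)

Section TwoRegular.
Variables (n : nat) (m : edge n -> nat).
Implicit Types (u v w : 'I_n) (e : edge n).
Hypotheses (n_gt2 : (2 < n)%N) (mC : mg_connected m).
Hypothesis deg2 : forall u, (\sum_(e : edge n | u \in val e) m e)%N = 2%N.

Definition adj : rel 'I_n := fun s t =>
  [exists e : edge n, (val e == [set s; t]%SET) && (0 < m e)%N].

Lemma adjP u v : reflect (exists2 e : edge n, val e = [set u; v]%SET & (0 < m e)%N) (adj u v).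
Proof.
apply: (iffP existsP) => [[e /andP[/eqP eE me]]|[e eE me]]; exists e => //.
by rewrite eE eqxx.
Qed.

Lemma adj_sym u v : adj u v = adj v u.
Proof. by apply/adjP/adjP => -[e eE me]; exists e; rewrite // finset.setUC. Qed.

Lemma adj_neq u v : adj u v -> u != v.
Proof. by move=> /adjP[e /edge_neq]. Qed.

Lemma adj_closed (A : {set 'I_n}) u :
  u \in A -> (forall v w, v \in A -> adj v w -> w \in A) -> forall v, v \in A.
Proof.
move=> uA clA v; have cl : closed adj (mem A).
  apply: intro_closed => [|x y xy xA]; last exact: clA xy.
  by apply: sym_connect_sym => x y; apply: adj_sym.
by rewrite -(closed_connect cl (mC u v)).
Qed.

Lemma adj_at_most2 u a b c :
  adj u a -> adj u b -> adj u c -> a != b -> c = a \/ c = b.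
Proof.
move=> /adjP[e eE me] /adjP[f fE mf] /adjP[g gE mg] ab.
have inu e' v : val e' = [set u; v]%SET -> u \in val e' by move=> ->; rewrite set21.
have inj e' f' v w : val e' = [set u; v]%SET -> val f' = [set u; w]%SET -> e' = f' -> v = w.
  by move=> eE' fE' ef; move: fE'; rewrite -ef eE' => /set2_eqP[[]|[-> ->]].
have fe : f != e by apply: contra ab => /eqP /esym /(inj _ _ _ _ eE fE)/eqP.
have := deg2 u; rewrite (bigD1 e) ?(inu _ _ eE) //= (bigD1 f) ?(inu _ _ fE) //=.
have [ge|ge] := eqVneq g e; first by left; apply: inj gE eE ge.
have [gf|gf] := eqVneq g f; first by right; apply: inj gE fE gf.
by rewrite (bigD1 g) ?(inu _ _ gE) ?ge ?gf //=; lia.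
Qed.

(** The ends of a double edge have no other edges, so they would form a
    component. *)
Lemma mult_le1 e : (m e <= 1)%N.
Proof.
rewrite leqNgt; apply/negP => me; have [u [v [uv eE]]] := edge_ends e.
have only w (f : edge n) : w \in val e -> w \in val f -> (0 < m f)%N -> f = e.
  move=> we wf mf; apply/eqP/negPn/negP => fe.
  by have := deg2 w; rewrite (bigD1 e) //= (bigD1 f) ?wf //=; lia.
have uA : u \in [set u; v]%SET by rewrite set21.
have : forall w, w \in [set u; v]%SET.
  apply: (adj_closed uA) => s t; rewrite -eE => se /adjP[f fE mf].
  by rewrite -(only s f) // fE ?set21 ?set22.
move=> all; have : (#|[set u; v]%SET| = n)%N.
  by rewrite (eq_card (B := 'I_n)) ?card_ord // => w; rewrite all inE.
by rewrite cards2 uv; lia.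
Qed.

(** A vertex with a single neighbour would carry a double edge, which the
    degree condition and connectedness exclude for more than two vertices. *)
Lemma adj_two u : exists a b, [/\ a != b, adj u a & adj u b].
Proof.
have nb (e : edge n) : u \in val e -> (0 < m e)%N -> exists2 a, adj u a & val e = [set u; a]%SET.
  move=> ue me; have [s [t [st eE]]] := edge_ends e.
  move: ue; rewrite eE => /set2P[us|ut].
    by exists t; rewrite us //; apply/adjP; exists e.
  exists s; last by rewrite ut finset.setUC.
  by apply/adjP; exists e; rewrite // eE ut finset.setUC.
have [e /andP[ue me]] : exists e : edge n, (u \in val e) && (0 < m e)%N.
  apply/existsP; apply: contraT => /existsPn ne; have := deg2 u.
  rewrite big1 // => e ue; have := ne e; rewrite ue /= -leqNgt; lia.
have [f /and3P[uf fe mf]] : exists f : edge n, [&& u \in val f, f != e & (0 < m f)%N].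
  apply/existsP; apply: contraT => /existsPn nf; have := deg2 u.
  rewrite (bigD1 e) //= big1 => [|f /andP[uf fe]]; first by have := mult_le1 e; lia.
  by have := nf f; rewrite uf fe /=; lia.
have [a ua aE] := nb e ue me; have [b ub bE] := nb f uf mf.
exists a, b; split=> //; apply: contra fe => /eqP ab.
by rewrite -val_eqE /= aE bE ab.
Qed.

Lemma maximal_path : exists x s,
  [/\ path adj x s, uniq (x :: s) & forall y, adj x y -> y \in x :: s].
Proof.
pose x0 : 'I_n := Ordinal (ltn_trans (ltn0Sn 1) n_gt2).
suff grow k x s : path adj x s -> uniq (x :: s) -> (n - size s <= k)%N ->
    exists x s, [/\ path adj x s, uniq (x :: s) & forall y, adj x y -> y \in x :: s].
  exact: (grow n x0 [::] isT isT (leq_subr _ _)).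
elim: k x s => [|k IH] x s xs xU sk.
  have : (size (x :: s) <= n)%N.
    by rewrite -(card_uniqP xU) -[X in (_ <= X)%N]card_ord max_card.
  by rewrite /=; lia.
have [[y xy ys]|max] := pselect (exists2 y, adj x y & y \notin x :: s).
  apply: (IH y (x :: s)); rewrite /= ?ys //; first by rewrite adj_sym xy.
  by rewrite -addn1 subnDA; lia.
by exists x, s; split=> // y xy; apply/negPn/negP => ys; apply: max; exists y.
Qed.

(** Both neighbours of the first vertex of a maximal path lie on the path; the
    farther one closes a cycle of length at least 3. *)
Lemma exists_adj_cycle : exists c, [/\ cycle adj c, uniq c & (2 < size c)%N].
Proof.
have [x [s [xs xU xmax]]] := maximal_path; have [a [b [ab xa xb]]] := adj_two x.
have inS y : adj x y -> y \in s.
  by move=> xy; have := xmax y xy; rewrite inE eq_sym (negPf (adj_neq xy)).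
case: s xs xU inS {xmax} => [|y s] xs xU inS; first by have := inS a xa.
have [z xz zs] : exists2 z, adj x z & z \in s.
  have := inS a xa; have := inS b xb; rewrite !inE.
  have [ay|_] := eqVneq a y; last by move=> _ as_; exists a.
  by rewrite -ay eq_sym (negPf ab) => bs _; exists b.
case/splitPr: zs xs xU {inS} => s1 s2 xs xU.
exists (x :: y :: rcons s1 z); split; last by rewrite /= size_rcons.
  move: xs; rewrite /= cat_path /= => /and3P[-> ys1 /andP[s1z _]].
  by rewrite rcons_path rcons_path ys1 s1z last_rcons adj_sym.
by apply: subseq_uniq xU; rewrite -cat_rcons -!cat_cons prefix_subseq.
Qed.

(** A vertex of a cycle has both its neighbours on the cycle, so the cycle is
    closed under adjacency and exhausts the connected graph. *)
Lemma two_regular_hamilton : exists p,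
  [/\ uniq p, p =i 'I_n & forall e, m e = (e \in cycle_edges p)].
Proof.
have [p [pC pU ps]] := exists_adj_cycle; exists p.
have [u0 u0p] : exists u, u \in p.
  by case: p ps {pC pU} => // u p _; exists u; rewrite mem_head.
have nbrs u w : u \in p -> adj u w -> w = next p u \/ w = prev p u.
  move=> up uw; apply: (adj_at_most2 (next_cycle pC up) _ uw).
    by rewrite adj_sym (prev_cycle pC up).
  apply/eqP => e; have [_] := next_next_neq pU ps up.
  by rewrite e next_prev // eqxx.
have pT u : u \in p.
  have := @adj_closed [set v | v \in p]%SET u0; rewrite inE => /(_ u0p).
  move=> /(_ _ u); rewrite inE; apply=> v w; rewrite !inE => vp /(nbrs _ _ vp).
  by case=> ->; rewrite ?mem_next ?mem_prev.
split=> // e; have := mult_le1 e; case: (boolP (e \in cycle_edges p)).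
  rewrite inE => /existsP[u /andP[up /eqP eE]].
  have /adjP[f fE mf] := next_cycle pC up.
  by have -> : e = f by [apply: val_inj; rewrite eE fE]; lia.
have [u [v [uv eE]]] := edge_ends e; rewrite inE => /existsP ne me.
have [m0|m0] := posnP (m e); first by rewrite m0.
have uv' : adj u v by apply/adjP; exists e.
case: ne; case: (nbrs _ _ (pT u) uv') => vE.
  by exists u; rewrite pT -vE eE eqxx.
by exists v; rewrite pT vE next_prev // -vE eE finset.setUC eqxx.
Qed.

End TwoRegular.

Section StspFace.
Variables (R : realType) (n : nat).
Hypothesis n_gt2 : (2 < n)%N.

Lemma tour_mult_degree (m : edge n -> nat) u :
  mg_connected m -> mg_even m -> (1 < \sum_(e : edge n | u \in val e) m e)%N.
Proof.
move=> mC mE; have := mE u; case E: (\sum_(e | _) _)%N => [|[|k]] //= _.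
have Z (e : edge n) : u \in val e -> m e = 0%N.
  by move=> ue; apply/eqP; move: E; rewrite (bigD1 e) //=; lia.
have [v uv] : exists v, v != u.
  pose i0 : 'I_n := Ordinal (ltn_trans (ltn0Sn 1) n_gt2).
  pose i1 : 'I_n := Ordinal (ltn_trans (ltnSn 1) n_gt2).
  by have [<-|] := eqVneq i0 u; [exists i1|exists i0].
have /connectP[[|w s]] := mC u v; first by move=> _ /= e; rewrite e eqxx in uv.
move=> /= /andP[/existsP[e /andP[/eqP eE]] ]; by rewrite (Z e) //= eE set21.
Qed.

(** Both claims survive convex combinations: a convex combination with all
    degree inequalities tight only involves points where they are tight. *)
Lemma stsp_face (x : vec R n) :
  gtsp R n x -> (forall u, 1 <= dot (delta R u) x) /\
    ((forall u, dot (delta R u) x = 1) -> stsp R n x).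
Proof.
move: x; apply: gtsp_min => [x y t /andP[t0 t1] [x1 xS] [y1 yS]|m mC mE].
  have t1' : 0 < 1 - t by lra.
  have ge u : 0 <= t * (dot (delta R u) x - 1) by rewrite mulr_ge0 ?subr_ge0 // ltW.
  have ge' u : 0 <= (1 - t) * (dot (delta R u) y - 1) by rewrite mulr_ge0 ?subr_ge0 // ltW.
  split=> [u|one]; first by rewrite dotDr !dotZr; have := ge u; have := ge' u; lra.
  apply: convex_hull_conv; first by rewrite !ltW.
    apply: xS => u; have := one u; rewrite dotDr !dotZr; have := ge u; have := ge' u => h h' e.
    have /eqP : t * (dot (delta R u) x - 1) = 0 by lra.
    by rewrite mulf_eq0 gt_eqF //= subr_eq0 => /eqP.
  apply: yS => u; have := one u; rewrite dotDr !dotZr; have := ge u; have := ge' u => h h' e.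
  have /eqP : (1 - t) * (dot (delta R u) y - 1) = 0 by lra.
  by rewrite mulf_eq0 gt_eqF //= subr_eq0 => /eqP.
split=> [u|one].
  rewrite delta_mult mulrC ler_pdivlMr // mul1r ler_nat; exact: tour_mult_degree.
have deg2 u : (\sum_(e : edge n | u \in val e) m e)%N = 2%N.
  by apply/eqP; rewrite -(eqr_nat R); have := one u; rewrite delta_mult => h; apply/eqP; lra.
have [p [pU pT mp]] := two_regular_hamilton n_gt2 mC deg2.
have -> : mult_vec R m = char_vec R (cycle_edges p).
  by apply/ffunP => e; rewrite !ffunE mp.
exact: stsp_tour_vec.
Qed.

End StspFace.

(** * Detours and the triangle inequality *)

Section Surgery.
Variables (R : realType) (n : nat).
Implicit Types (u v w : 'I_n) (e f g : edge n) (m : edge n -> nat).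
Implicit Types (a x y z : vec R n) (c : vec R n * R) (F : set (vec R n)).
Local Notation P := (gtsp R n).

Lemma unit_vecE e f : (unit_vec R e f : R) = (f == e)%:R.
Proof. by rewrite ffunE. Qed.

Lemma mult_vecE m e : (mult_vec R m e : R) = (m e)%:R.
Proof. by rewrite ffunE. Qed.

Lemma detour_entry x e f g h :
  ((x - unit_vec R e + unit_vec R f + unit_vec R g) h : R) =
  (x h : R) - (h == e)%:R + (h == f)%:R + (h == g)%:R.
Proof.
have gen y y' z : ((x - y + y' + z) h : R) = (x h : R) - (y h : R) + (y' h : R) + (z h : R).
  by rewrite !ffunE.
by apply: etrans (gen _ _ _) _; congr (_ - _ + _ + _); exact: unit_vecE.
Qed.

Lemma dot_detour a x e f g :
  dot a (x - unit_vec R e + unit_vec R f + unit_vec R g) =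
  dot a x - (a e : R) + (a f : R) + (a g : R).
Proof.
rewrite -(dot_unit a e) -(dot_unit a f) -(dot_unit a g).
by move: (unit_vec R e) (unit_vec R f) (unit_vec R g) => y y' z; rewrite !dotDr dotNr.
Qed.

Definition detour m e f g : edge n -> nat :=
  fun h => (m h - (h == e) + (h == f) + (h == g))%N.

(** Wherever e was used, f and g connect its ends, and the degrees change by 0
    or 2. *)
Lemma detour_tour m e f g u v w :
    u != v -> u != w -> (0 < m e)%N ->
    val e = [set v; w]%SET -> val f = [set v; u]%SET -> val g = [set u; w]%SET ->
    mg_connected m -> mg_even m ->
  mg_connected (detour m e f g) /\ mg_even (detour m e f g).
Proof.
move=> uv uw me eE fE gE mC mE; have vw := edge_neq eE.
set m' := detour m e f g.
have gt0 h : (0 < m h)%N -> h != e -> (0 < m' h)%N.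
  by rewrite /m' /detour => mh /negPf ->; lia.
have mf : (0 < m' f)%N by rewrite /m' /detour eqxx; lia.
have mg : (0 < m' g)%N by rewrite /m' /detour eqxx; lia.
split.
  move=> s t; apply: connect_sub (mC s t) => {}s {}t /existsP[h /andP[/eqP hE mh]].
  have step (a b : 'I_n) (k : edge n) : val k = [set a; b]%SET -> (0 < m' k)%N ->
      connect (fun s t => [exists e : edge n, (val e == [set s; t]%SET) && (0 < m' e)%N])
        a b.
    by move=> kE mk; apply/connect1/existsP; exists k; rewrite kE eqxx.
  have [he|he] := eqVneq h e; last by apply: step hE _; apply: gt0.
  have fE' : val f = [set u; v]%SET by rewrite fE finset.setUC.
  have gE' : val g = [set w; u]%SET by rewrite gE finset.setUC.
  move: hE; rewrite he eE => /set2_eqP[[<- <-]|[<- <-]].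
    exact: connect_trans (step _ _ f fE mf) (step _ _ g gE mg).
  exact: connect_trans (step _ _ g gE' mg) (step _ _ f fE' mf).
move=> z; have sum1 h : (\sum_(k : edge n | z \in val k) (k == h))%N = (z \in val h) :> nat.
  case: (boolP (z \in val h)) => zh; last first.
    by apply: big1 => k zk; case: eqVneq => // kh; rewrite -kh zk in zh.
  by rewrite (bigD1 h) //= eqxx big1 // => k /andP[_ /negPf ->].
have : (\sum_(k : edge n | z \in val k) m' k + (z \in val e) =
    \sum_(k : edge n | z \in val k) m k + (z \in val f) + (z \in val g))%N.
  rewrite -!sum1 -!big_split /=; apply: eq_bigr => k _; rewrite /m' /detour.
  case: (eqVneq k e) => [->|_]; rewrite ?addn0 ?subn0 //=.
  by case: (m e) me => // i _; move: (nat_of_bool _) (nat_of_bool _) => a b; lia.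
move=> /(congr1 odd); rewrite !oddD (negPf (mE z)) !oddb eE fE gE !inE.
move: (odd _); have [zv|zv] := eqVneq z v; have [zw|zw] := eqVneq z w;
  have [zu|zu] := eqVneq z u; subst; rewrite ?eqxx // in uv uw vw *; by case.
Qed.

Lemma mult_vec_detour m e f g : (0 < m e)%N ->
  mult_vec R (detour m e f g) =
  mult_vec R m - unit_vec R e + unit_vec R f + unit_vec R g.
Proof.
move=> me; apply/ffunP => h; rewrite [RHS]detour_entry !mult_vecE.
rewrite /detour !natrD natrB //; by case: eqVneq => // ->.
Qed.

(** A convex combination in the face with a positive entry at e involves some
    tour of the face that uses e. *)
Lemma face_tour_through c e x :
    valid P c.1 c.2 -> face P c x -> 0 < (x e : R) ->
  exists m, [/\ mg_connected m, mg_even m, slack c (mult_vec R m) = 0 & (0 < m e)%N].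
Proof.
move=> /valid_slack cv /faceE[Px cx] xe; apply: contrapT => nm.
suff /(_ x Px)[_ [_ /(_ cx)]] : P `<=` [set x | 0 <= slack c x /\
    (0 <= (x e : R) /\ (slack c x = 0 -> (x e : R) = 0))] by lra.
apply: gtsp_min => [y z t /andP[t0 t1] [cy [ye y0]] [cz [ze z0]]|m mC mE].
  have t1' : 0 < 1 - t by lra.
  have sE : slack c (t *: y + (1 - t) *: z) = t * slack c y + (1 - t) * slack c z.
    by rewrite /slack dotDr !dotZr; ring.
  have h := mulr_ge0 (ltW t0) cy; have h' := mulr_ge0 (ltW t1') cz.
  split; first by rewrite sE addr_ge0.
  rewrite !ffunE; split.
    by apply: addr_ge0; apply: mulr_ge0 => //; exact: ltW.
  rewrite sE => s0; rewrite /GRing.scale /= y0 ?z0 ?mulr0 ?addr0 //.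
    have /eqP : (1 - t) * slack c z = 0 by lra.
    by rewrite mulf_eq0 gt_eqF //= => /eqP.
  have /eqP : t * slack c y = 0 by lra.
  by rewrite mulf_eq0 gt_eqF //= => /eqP.
have Pm := @gtsp_tour R _ _ mC mE; split; first exact: cv.
rewrite mult_vecE ler0n; split=> // c0; apply/eqP; rewrite pnatr_eq0 -leqn0 leqNgt.
by apply/negP => me; apply: nm; exists m.
Qed.

Lemma gtsp_nonneg x e : P x -> 0 <= (x e : R).
Proof.
move: x; apply: gtsp_min => [y z t /andP[t0 t1] ye ze|m _ _]; last by rewrite mult_vecE ler0n.
by rewrite !ffunE; apply: addr_ge0; apply: mulr_ge0 => //; rewrite ?subr_ge0 ltW.
Qed.

Lemma unit_valid e : valid P (unit_vec R e) 0.
Proof. by move=> x /gtsp_nonneg; rewrite dotC dot_unit. Qed.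

Lemma delta_valid u : (2 < n)%N -> valid P (delta R u) 1.
Proof. by move=> n2 x /(stsp_face n2)[]. Qed.

Lemma unit_neq0 e : unit_vec R e != 0.
Proof.
apply/eqP => /ffunP/(_ e); rewrite unit_vecE ffunE eqxx => /eqP.
by rewrite (oner_eq0 R).
Qed.

Lemma delta_neq0 u : (2 < n)%N -> delta R u != 0.
Proof.
move=> n2; apply/eqP => d0.
have [o [Po _]] := gtsp_interior R n; have := delta_valid u n2 Po.
by rewrite d0 dot0l ler10.
Qed.

(** Take a tour of the facet that uses the edge vw.  Its detour over u is in P,
    and the inequality of the facet compares the two. *)
Lemma facet_triangle c : (2 < n)%N ->
    valid P c.1 c.2 -> facet P (face P c) -> ~ nonneg_facet (face P c) ->
  triangle_ineq c.1.
Proof.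
move=> n2 cv cF nF u v w f g e uv uw vw fE gE eE.
have [o Po] := gtsp_interior R n; have [I PI] := gtsp_polyhedral R n.
have [x Fx xe] : exists2 x, face P c x & 0 < (x e : R).
  apply: contrapT => nx; apply: nF; split=> //; exists e.
  apply: (facet_defined Po PI cF (d := (unit_vec R e, 0)) (defines_face cv)).
  - exact: unit_valid.
  - exact: unit_neq0.
  move=> x Fx; rewrite /slack /= dotC dot_unit subr0; apply: le_anti.
  rewrite gtsp_nonneg ?andbT; last by case: Fx.
  by rewrite leNgt; apply/negP => xe; apply: nx; exists x.
have [m [mC mE cm me]] := face_tour_through cv Fx xe.
have [dC dE] := detour_tour uv uw me eE fE gE mC mE.
have := (valid_slack _ _).1 cv _ (@gtsp_tour R _ _ dC dE).
by rewrite mult_vec_detour // /slack dot_detour; move: cm; rewrite /slack; lra.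
Qed.

End Surgery.

(** * Linear functions that are constant on Hamilton cycles *)

Section SpanOfTours.
Variables (R : realType) (n : nat).
Implicit Types (u v w x y : 'I_n) (e f g : edge n) (p s : seq 'I_n).
Implicit Types (a : vec R n) (c : vec R n * R).
Local Notation P := (gtsp R n).
Local Notation tour_vec p := (char_vec R (cycle_edges p)).
Hypothesis n_gt3 : (3 < n)%N.
Let n_gt2 : (2 < n)%N. Proof. exact: ltnW. Qed.

Lemma deltaE e u v w : val e = [set v; w]%SET ->
  (delta R u e : R) = 2^-1 * ((u == v)%:R + (u == w)%:R).
Proof.
by move=> eE; rewrite -delta_pair ?(edge_neq eE) // (pair_vec_unit R eE) dot_unit.
Qed.

Definition extend_tour s := s ++ [seq u <- enum 'I_n | u \notin s].

Lemma extend_tour_uniq s : uniq s -> uniq (extend_tour s).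
Proof.
move=> sU; rewrite cat_uniq sU filter_uniq ?enum_uniq // andbT /=.
by apply/hasPn => u; rewrite mem_filter => /andP[].
Qed.

Lemma extend_tour_full s : extend_tour s =i 'I_n.
Proof. by move=> u; rewrite mem_cat mem_filter mem_enum inE andbT orbN. Qed.

Lemma fresh_vertex s : (size s < n)%N -> exists u, u \notin s.
Proof.
move=> sn; apply: contrapT => ns; have : (#|'I_n| <= size s)%N.
  apply: leq_trans (card_size s); apply/subset_leq_card/fintype.subsetP => u _.
  by apply/negPn/negP => us; apply: ns; exists u.
by rewrite card_ord leqNgt sn.
Qed.

Definition weight a u v : R := dot a (pair_vec R u v).

Lemma weightC a u v : weight a u v = weight a v u.
Proof. by rewrite /weight pair_vecC. Qed.

Lemma dot_tour a p : uniq p -> p =i 'I_n ->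
  dot a (tour_vec p) = \sum_(uv <- zip p (rot 1 p)) weight a uv.1 uv.2.
Proof.
move=> pU pT; rewrite cycle_vec // ?(tour_size pU pT) // dot_sumr.
exact: (big_next (weight a)).
Qed.

(** The tours x y z w ... and x z y w ... have the same edges except for xy, zw
    and xz, yw. *)
Lemma exchange a t x y z w :
    (forall p, uniq p -> p =i 'I_n -> dot a (tour_vec p) = t) ->
    uniq [:: x; y; z; w] ->
  weight a x y + weight a z w = weight a x z + weight a y w.
Proof.
move=> aT sU; set r := [seq u <- enum 'I_n | u \notin [:: x; y; z; w]].
have pU := extend_tour_uniq sU; have pT := extend_tour_full [:: x; y; z; w].
pose p' := [:: x, z, y, w & r].
have pp' : perm_eq [:: x, y, z, w & r] p'.
  by rewrite perm_cons -(cat1s y) -(cat1s z) perm_catCA.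
have p'U : uniq p' by rewrite -(perm_uniq pp').
have p'T : p' =i 'I_n by move=> u; rewrite -(perm_mem pp') pT.
have := etrans (esym (dot_tour a pU pT)) (aT _ pU pT).
have := etrans (esym (dot_tour a p'U p'T)) (aT _ p'U p'T).
rewrite /extend_tour /p' !rot1_cons /= !big_cons /= (weightC a z y); lra.
Qed.

(** Under the exchange property the excess of a triangle at u does not change
    when one of the other two vertices is replaced, and any pair is reached from
    any other in this way. *)
Lemma exchange_excess (W : 'I_n -> 'I_n -> R) :
    (forall u v, W u v = W v u) ->
    (forall x y z w, uniq [:: x; y; z; w] -> W x y + W z w = W x z + W y w) ->
  exists l : 'I_n -> R, forall u v w, uniq [:: u; v; w] ->
    W u v + W u w - W v w = l u.
Proof.
move=> WC Wex; pose T u v w := W u v + W u w - W v w.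
have TC u v w : T u v w = T u w v by rewrite /T (WC v w); ring.
have Texch u v w x : uniq [:: u; v; x; w] -> T u v w = T u x w.
  by move=> /Wex; rewrite /T; lra.
apply: (@fin_all_exists _ (fun=> R) (fun u r => forall v w, uniq [:: u; v; w] -> T u v w = r)) => u.
have [x] : exists x, x \notin [:: u] by apply: fresh_vertex; rewrite /=; lia.
rewrite inE => xu.
have [y] : exists y, y \notin [:: u; x] by apply: fresh_vertex.
rewrite !inE negb_or => /andP[yu yx].
have base w : w != u -> w != x -> T u x w = T u x y.
  move=> wu wx; have [->//|wy] := eqVneq w y.
  apply: etrans (TC _ _ _) (etrans (Texch u w x y _) (TC _ _ _)).
  by rewrite /= !inE !negb_or !(eq_sym u) wu xu yu wy wx yx.
exists (T u x y) => v w; rewrite /= !inE !negb_or !(eq_sym u) andbT.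
move=> /andP[/andP[vu wu] vw]; have [vx|vx] := eqVneq v x.
  by rewrite vx; apply: base; rewrite // -vx eq_sym.
have [wx|wx] := eqVneq w x; first by rewrite wx; apply: etrans (TC _ _ _) (base _ _ _).
apply: etrans (Texch u v w x _) (base _ _ _) => //.
by rewrite /= !inE !negb_or !(eq_sym u) vu wu xu vw vx (eq_sym x) wx.
Qed.

(** The coefficient of u is the common excess at u of all triangles: the
    excesses at the two ends of an edge add up to twice its weight. *)
Lemma tour_constant_delta a t :
    (forall p, uniq p -> p =i 'I_n -> dot a (tour_vec p) = t) ->
  exists l : 'I_n -> R, a = \sum_u l u *: delta R u.
Proof.
move=> aT; have [l lP] := exchange_excess (weightC a) (fun x y z w => @exchange a t x y z w aT).
exists l; apply/ffunP => e; have [v [w [vw eE]]] := edge_ends e.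
rewrite -[LHS]dot_unit -[RHS]dot_unit -(pair_vec_unit R eE) [RHS]dotC dot_sumr.
have [x] : exists x, x \notin [:: v; w] by apply: fresh_vertex.
rewrite !inE negb_or => /andP[xv xw].
have lv : weight a v w + weight a v x - weight a w x = l v.
  by apply: lP; rewrite /= !inE negb_or vw !(eq_sym _ x) xv xw.
have lw : weight a w v + weight a w x - weight a v x = l w.
  by apply: lP; rewrite /= !inE negb_or eq_sym vw !(eq_sym _ x) xv xw.
rewrite (bigD1 v) //= (bigD1 w) 1?eq_sym //= big1 => [|u /andP[uv uw]]; last first.
  by rewrite dotZr dotC delta_pair // (negPf uv) (negPf uw) addr0 !mulr0.
have dE u : dot (pair_vec R v w) (l u *: delta R u) =
    l u * (2^-1 * ((u == v)%:R + (u == w)%:R)).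
  by rewrite dotZr dotC delta_pair.
rewrite !dE !eqxx (negPf vw) eq_sym (negPf vw) -lv -lw (weightC a w v) -/(weight a v w).
by move: (weight a v w) (weight a v x) (weight a w x) => r s k /=; field.
Qed.

(** By [tour_constant_delta] the normal is a combination of the vectors
    [delta u].  Evaluating at a Hamilton cycle with a detour over u shows that the
    coefficient of u is non-negative, so the facet lies in the degree facet of
    every u with a positive coefficient. *)
Lemma tour_constant_facet c :
    valid P c.1 c.2 -> facet P (face P c) ->
    (forall p, uniq p -> p =i 'I_n -> slack c (tour_vec p) = 0) ->
  degree_facet (face P c).
Proof.
move=> cv cF c0; have [o Po] := gtsp_interior R n; have [I PI] := gtsp_polyhedral R n.
have [l lE] : exists l : 'I_n -> R, c.1 = \sum_u l u *: delta R u.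
  apply: (@tour_constant_delta _ c.2) => p pU pT.
  by apply/eqP; rewrite -subr_eq0; apply/eqP/c0.
have [p0 [p0U p0T]] : exists p0 : seq 'I_n, uniq p0 /\ p0 =i 'I_n.
  by exists (extend_tour [::]); split; [exact: extend_tour_uniq|exact: extend_tour_full].
have dotE z : dot c.1 z = \sum_u l u * dot (delta R u) z.
  by rewrite lE dotC dot_sumr; apply: eq_bigr => u _; rewrite dotZr dotC.
have cE : c.2 = \sum_u l u.
  have := c0 p0 p0U p0T; rewrite /slack dotE => /eqP; rewrite subr_eq0 => /eqP <-.
  by apply: eq_bigr => u _; rewrite delta_tour ?mulr1.
have sE z : slack c z = \sum_u l u * (dot (delta R u) z - 1).
  by rewrite /slack dotE cE -sumrB; apply: eq_bigr => u _; rewrite mulrBr mulr1.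
have l0 u : 0 <= l u.
  have [v] : exists v, v \notin [:: u] by apply: fresh_vertex; rewrite /=; lia.
  have [w] : exists w, w \notin [:: u; v] by apply: fresh_vertex.
  rewrite !inE negb_or => /andP[wu wv] vu.
  have sU : uniq [:: v; w; u] by rewrite /= !inE negb_or !(eq_sym v) wv eq_sym vu wu.
  have pU := extend_tour_uniq sU; have pT := extend_tour_full [:: v; w; u].
  set p := extend_tour _ in pU pT.
  have vw : v != w by rewrite eq_sym.
  have [e eE] := edge_exists vw; have [f fE] := edge_exists vu.
  have uw : u != w by rewrite eq_sym.
  have uv : u != v by rewrite eq_sym.
  have [g gE] := edge_exists uw.
  have ep : (0 < (e \in cycle_edges p))%N.
    rewrite lt0b inE; apply/existsP; exists v; rewrite pT eE.
    by rewrite /p /extend_tour /= eqxx eqxx.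
  have [dC dE] := detour_tour uv uw ep eE fE gE (tour_connected n_gt2 pU pT)
    (tour_even R n_gt2 pU pT).
  have := (valid_slack _ _).1 cv _ (@gtsp_tour R _ _ dC dE).
  rewrite mult_vec_detour // -tour_char_mult sE (bigD1 u) //= big1 ?addr0 => [|z zu].
    rewrite dot_detour delta_tour // (deltaE _ eE) (deltaE _ fE) (deltaE _ gE).
    by rewrite !eqxx (negPf uv) (negPf uw) /=; lra.
  rewrite dot_detour delta_tour // (deltaE _ eE) (deltaE _ fE) (deltaE _ gE) (negPf zu).
  by rewrite !addr0 !add0r; ring.
have [u lu] : exists u, 0 < l u.
  apply: contrapT => nl; have /eqP := facet_nonzero Po PI cv cF; apply.
  rewrite lE big1 // => u _; have -> : l u = 0; last by rewrite scale0r.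
  apply: le_anti; rewrite l0 andbT leNgt; apply/negP => lu; apply: nl; by exists u.
split=> //; exists u.
apply: (facet_defined Po PI cF (d := (delta R u, 1)) (defines_face cv)).
- exact: delta_valid.
- exact: delta_neq0.
move=> x /faceE[Px]; rewrite sE => /psumr_eq0P.
have ge v : true -> 0 <= l v * (dot (delta R v) x - 1).
  by move=> _; rewrite mulr_ge0 // subr_ge0; apply: delta_valid.
by move=> /(_ ge u isT)/eqP; rewrite mulf_eq0 gt_eqF //= => /eqP.
Qed.

End SpanOfTours.

(** * NR-facets and the induced ridge graph *)

Section Assembly.
Variables (R : realType) (n : nat).
Implicit Types (u v w : 'I_n) (e f g : edge n) (x y q : vec R n).
Implicit Types (c : vec R n * R) (I : seq (vec R n * R)).
Local Notation P := (gtsp R n).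
Local Notation S := (stsp R n).
Local Notation tour_vec p := (char_vec R (cycle_edges p)).
Hypothesis n_gt3 : (3 < n)%N.
Let n_gt2 : (2 < n)%N. Proof. exact: ltnW. Qed.

Lemma slack_unit e x : slack (unit_vec R e, 0) x = (x e : R).
Proof. by rewrite /slack /= subr0 dotC dot_unit. Qed.

(** Irredundancy of the system of all facet inequalities of P other than the
    degree facets, taken inside the affine space where all degree inequalities are
    tight.  A strict point exists by [tour_constant_facet]. *)
Lemma nr_facet_separates I q :
    describes I P -> (forall c, c \in I -> facet P (face P c)) ->
    (forall u, dot (delta R u) q = 1) -> (forall e, 0 <= (q e : R)) -> ~ S q ->
  exists c, [/\ c \in I, slack c q < 0 & nr_facet (face P c)].
Proof.
move=> PI IF q1 q0 Sq; have [o Po] := gtsp_interior R n.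
have valid_I c : c \in I -> valid P c.1 c.2 by move=> cI; exact: describes_valid PI cI.
set I' := [seq c <- I | ~~ `[< degree_facet (face P c) >]].
pose U : {vspace vec R n} := (\bigcap_(u < n) dot_ker (delta R u))%VS.
have memU x : (x \in U) = [forall u, dot (delta R u) x == 0].
  apply/idP/forallP => [xU u|x0].
    by rewrite -mem_dot_ker; apply: (subvP (bigcapv_inf u _ _)) xU.
  by rewrite memvE; apply/subv_bigcapP => u _; rewrite -memvE mem_dot_ker.
have [x1 Sx1 x1I] : exists2 x, S x & forall c, c \in I' -> 0 < slack c x.
  pose p0 := extend_tour ([::] : seq 'I_n).
  have Sp0 : S (tour_vec p0).
    by apply: stsp_tour_vec => //; [exact: extend_tour_uniq|exact: extend_tour_full].
  apply: exists_strict_point Sp0 _ => [x y Sx Sy|c].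
    have -> : x + 2^-1 *: (y - x) = 2^-1 *: y + (1 - 2^-1) *: x.
      by rewrite scalerBr scalerBl scale1r addrCA [x - _]addrC addrA.
    by apply: convex_hull_conv Sy Sx; lra.
  rewrite mem_filter => /andP[/asboolPn cD cI]; have cv := valid_I c cI; split.
    by move=> x /(stsp_sub_gtsp n_gt2); apply: cv.
  apply: contrapT => nt; apply: cD; apply: (tour_constant_facet n_gt3 cv (IF c cI)) => p pU pT.
  have Sp : S (tour_vec p) by apply: stsp_tour_vec.
  apply: le_anti; rewrite ((valid_slack _ _).1 cv) ?andbT; last exact: stsp_sub_gtsp.
  by rewrite leNgt; apply/negP => cp; apply: nt; exists (tour_vec p).
have UE x : (x - x1 \in U) <-> forall u, dot (delta R u) x = 1.
  rewrite memU; split=> [/forallP xU u|x1']; last first.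
    by apply/forallP => u; rewrite dotBr x1' (stsp_delta u n_gt2 Sx1) subrr.
  by have /eqP := xU u; rewrite dotBr (stsp_delta u n_gt2 Sx1); lra.
have SE x : S x <-> cell x1 U I' x.
  split=> [Sx|[/UE x1' xI]].
    split; first by apply/UE => u; apply: stsp_delta.
    move=> c; rewrite mem_filter => /andP[_ cI].
    by apply/(PI x).1 => //; apply: stsp_sub_gtsp.
  apply: (stsp_face n_gt2 _).2 => //; apply/PI => c cI.
  have [cD|cD] := pselect (degree_facet (face P c)); last first.
    by apply: xI; rewrite mem_filter cI andbT; apply/asboolPn.
  have [_ [u cu]] := cD.
  (* the inequality of a degree facet is tight on the whole affine space *)
  have [r r0 rP] := defining_inequality_unique (d := (delta R u, 1)) Po PI
    (valid_I c cI) (IF c cI) cu.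
  by rewrite rP /slack /= x1' subrr mulr0.
have dimS : has_dim S (\dim U).
  apply: (has_dim_relative_interior (x0 := x1)) => [x /SE[]//|u uU].
  have [t /andP[t0 _] tP] := exists_small_step u x1I.
  exists t => //; apply/SE; split; first by rewrite addrAC subrr add0r memvZ.
  by move=> c cI; apply/ltW/tP; rewrite ?lexx ?ltW.
have [||c [cI' cq [k kU kF]]] := cell_facet x1I (q := q) (U := U).
- exact/UE.
- by move/SE.
have cI : c \in I by move: cI'; rewrite mem_filter => /andP[].
have cD : ~ degree_facet (face P c) by move: cI'; rewrite mem_filter => /andP[/asboolPn].
have cv := valid_I c cI.
exists c; split=> //; split; first split=> //; first exact: IF.
  move=> [_ [e ce]].
  have [r r0 rP] := defining_inequality_unique (d := (unit_vec R e, 0)) Po PI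
    cv (IF c cI) ce.
  by move: cq; rewrite rP slack_unit; have := mulr_ge0 (ltW r0) (q0 e); lra.
have eF : face P c `&` S = cell x1 U I' `&` [set x | slack c x = 0].
  apply/seteqP; split=> x.
    by move=> [/faceE[_ cx] /SE Sx].
  by move=> [/SE Sx /= cx]; split=> //; apply/faceE; split=> //; apply: stsp_sub_gtsp.
split; last by exists k; rewrite addn1 kU eF.
exists c.1, c.2; split; first by move=> x /(stsp_sub_gtsp n_gt2); apply: cv.
apply/seteqP; split=> x; first by move=> [[]].
by move=> [Sx cx]; split=> //; split=> //; apply: stsp_sub_gtsp.
Qed.

Section Relaxation.
Variables (m : nat) (B : 'I_m -> vec R n) (b : 'I_m -> R).
Hypothesis B_nr : forall i, exists2 F, nr_facet F & defines P (B i) (b i) F.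

Definition relaxation_system : seq (vec R n * R) :=
  [seq (B i, b i) | i <- enum 'I_m] ++
  [seq (delta R u, 1) | u <- enum 'I_n] ++
  [seq (unit_vec R e, 0) | e <- enum {: edge n}].

Lemma relaxation_system_valid c :
  c \in relaxation_system -> valid P c.1 c.2 /\ c.1 != 0.
Proof.
have [o Po] := gtsp_interior R n; have [I PI] := gtsp_polyhedral R n.
rewrite !mem_cat => /or3P[/mapP[i _ ->]|/mapP[u _ ->]|/mapP[e _ ->]] /=.
- have [F [[FF _ _] _] FB] := B_nr i; split; first by case: FB.
  by have [] := @facet_direction _ _ P o I Po PI F (B i, b i) FF FB.
- by split; [exact: delta_valid|exact: delta_neq0].
- by split; [exact: unit_valid|exact: unit_neq0].
Qed.

Lemma relaxation_systemE x :
  relaxation B b x <-> forall c, c \in relaxation_system -> 0 <= slack c x.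
Proof.
split=> [[xB x1 x0] c|xJ].
  rewrite !mem_cat => /or3P[/mapP[i _ ->]|/mapP[u _ ->]|/mapP[e _ ->]].
  - by rewrite subr_ge0; exact: xB.
  - by rewrite subr_ge0; exact: x1.
  - by rewrite slack_unit; exact: x0.
split=> [i|u|e].
- rewrite -subr_ge0; apply: (xJ (B i, b i)).
  by rewrite !mem_cat map_f ?mem_enum.
- rewrite -subr_ge0; apply: (xJ (delta R u, 1)).
  by rewrite !mem_cat (map_f (fun u => (delta R u, 1))) ?orbT // mem_enum.
- rewrite -slack_unit; apply: xJ.
  by rewrite !mem_cat (map_f (fun e => (unit_vec R e, 0))) ?orbT // mem_enum.
Qed.

Lemma GB_vertexE F : GB_vertex B b F <->
  facet P F /\ forall d, d \in relaxation_system -> ~ defines P d.1 d.2 F.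
Proof.
split=> [[FF Fr Fd Fn]|[FF Fs]].
  split=> // d; rewrite !mem_cat.
  move=> /or3P[/mapP[i _ ->]|/mapP[u _ ->]|/mapP[e _ ->]] dF.
  - by apply: Fr; split=> //; exists i.
  - by apply: Fd; split=> //; exists u.
  - by apply: Fn; split=> //; exists e.
split=> // -[_ [i]]; [apply: (Fs (B i, b i))|apply: (Fs (delta R i, 1))|
  apply: (Fs (unit_vec R i, 0))]; rewrite !mem_cat.
- by rewrite map_f ?mem_enum.
- by rewrite (map_f (fun u => (delta R u, 1))) ?orbT // mem_enum.
- by rewrite (map_f (fun e => (unit_vec R e, 0))) ?orbT // mem_enum.
Qed.

(** A small step across F from a relative interior point of F, at which the
    whole relaxation is strict because none of its inequalities defines F. *)
Lemma exists_point_beyond c :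
    valid P c.1 c.2 -> GB_vertex B b (face P c) ->
  exists2 x, slack c x < 0 & forall d, d \in relaxation_system -> 0 < slack d x.
Proof.
have [o Po] := gtsp_interior R n; have [I PI] := gtsp_polyhedral R n.
move=> cv /GB_vertexE[cF cs].
have [g /faceE[Pg cg] gJ] := facet_relative_interior Po PI cv cF relaxation_system_valid.
have gpos d : d \in relaxation_system -> 0 < slack d g.
  move=> dJ; have [//|[r r0 rP]] := gJ d dJ; case: (cs d dJ).
  rewrite -(face_proportional _ r0 rP); apply: defines_face.
  by have [] := relaxation_system_valid dJ.
have [t /andP[t0 _] tP] := exists_small_step (g - o) gpos.
exists (g + t *: (g - o)); last by move=> d dJ; apply: tP; rewrite // lexx ltW.
have co := Po.2 c cv (facet_nonzero Po PI cv cF).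
have go : dot c.1 g - dot c.1 o = - slack c o by move: cg; rewrite /slack; lra.
by have := mulr_gt0 t0 co; rewrite slackZ cg dotBr go mulrN; lra.
Qed.

Lemma component_contains_nr_facet F : parsimonious B b -> GB_vertex B b F ->
  exists2 G, clos_refl_trans _ (fun X Y =>
    [/\ GB_vertex B b X, GB_vertex B b Y & ridge_adj X Y]) F G & nr_facet G.
Proof.
move=> pars VF; have [o Po] := gtsp_interior R n.
have [I0 PI0] := gtsp_polyhedral R n.
have [I PI IF] := exists_facet_description Po PI0.
have [[[a [al [cv FE]]] _] _ _ Fn] := VF; pose c := (a, al).
have {FE} FE : F = face P c by []; rewrite {}FE in VF Fn *.
have [cF _ _ _] := VF; have {}cv : valid P c.1 c.2 by [].
have [x cx xJ] := exists_point_beyond cv VF.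
have [t [[_ tx] [[q [qB q1 q0] qt] _]]] := pars c.1 (facet_triangle n_gt2 cv cF Fn).
have qR : relaxation B b q by split=> // u; rewrite q1.
have cq : slack c q < 0.
  have : t <= dot c.1 x.
    by apply: tx; exists x => //; apply/relaxation_systemE => d /xJ/ltW.
  by rewrite -qt; move: cx; rewrite /slack; lra.
have Sq : ~ S q.
  by move=> /(stsp_sub_gtsp n_gt2)/((valid_slack _ _).1 cv); lra.
have [c0 [c0I c0q c0N]] := nr_facet_separates PI IF q1 q0 Sq.
exists (face P c0) => //.
have c0v : valid P c0.1 c0.2 by exact: describes_valid PI c0I.
(* With the opposite inequality, violating c0 becomes a strict inequality at q. *)
pose c0' := (- c0.1, - c0.2).
have c0'E z : slack c0' z = - slack c0 z.
  by rewrite /slack /= dotC dotNr dotC; ring.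
have [s /andP[s0 s1] sP] : exists2 s, 0 < s < 1 &
    forall d r, d \in [:: c0'] -> 0 <= r <= s -> 0 < slack d (q + r *: (x - q)).
  by apply: exists_small_step => d; rewrite inE => /eqP ->; rewrite c0'E; lra.
set y := q + s *: (x - q).
have c0y : slack c0 y < 0.
  by have := sP c0' s (mem_head _ _); rewrite c0'E lexx ltW // => /(_ isT); lra.
have cy : slack c y < 0.
  have s1' : 0 < 1 - s by lra.
  have := mulr_gt0 s0 (_ : 0 < - slack c x); have := mulr_gt0 s1' (_ : 0 < - slack c q).
  by rewrite slack_seg !oppr_gt0 => /(_ cq) + /(_ cx); lra.
have yJ d : d \in relaxation_system -> 0 < slack d y.
  move=> dJ; rewrite slack_seg; apply: ltr_wpDl; last by apply: mulr_gt0; [|exact: xJ].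
  by apply: mulr_ge0; [lra|exact: (relaxation_systemE q).1].
have PIc : describes (c :: I) P.
  move=> z; split=> [Pz d|zI].
    by rewrite inE => /orP[/eqP ->|]; [exact: (valid_slack _ _).1 cv _ Pz|exact: (PI z).1].
  by apply/PI => d dI; apply: zI; rewrite inE dI orbT.
have IFc d : d \in c :: I -> facet P (face P d).
  by rewrite inE => /orP[/eqP ->|/IF].
have c0Ic : c0 \in c :: I by rewrite inE c0I orbT.
apply: (visible_facets_connected Po PI0 PIc IFc _ (mem_head _ _) cy c0Ic c0y) => d dI dy.
apply/GB_vertexE; split=> [|e eJ eF]; first exact: IFc.
have [r r0 rP] := defining_inequality_unique Po PI0 (describes_valid PIc dI) (IFc d dI) eF.
by have := mulr_gt0 r0 (yJ e eJ); rewrite -rP; lra.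
Qed.

End Relaxation.
End Assembly.

Theorem theorem3p5 (R : realType) (n : nat) (n_ge5 : (5 <= n)%N)
  (m : nat) (B : 'I_m -> vec R n) (b : 'I_m -> R)
  (B_nr : forall i, exists2 F, nr_facet F & defines (gtsp R n) (B i) (b i) F)
  (B_pars : parsimonious B b)
  (K : set (set (vec R n))) :
  connected_component (GB_vertex B b) (@ridge_adj R n) K ->
  exists2 G, K G & nr_facet G.
Proof.
move=> [F VF ->].
exact: (component_contains_nr_facet (ltnW n_ge5) B_nr B_pars VF).
Qed.
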